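(* Let $V=\mathbb{R}^r$. For a crystallographic arrangement $(\mathcal{A},R)$ in $V$ put $M_R:=\sum_{\alpha\in R}\mathbb{Z}\alpha\subseteq V^*$, let $N_R\subseteq V$ be the lattice dual to $M_R$, and let $\Sigma_R$ be the set of all intersections of closed chambers of $\mathcal{A}$, regarded as a fan in $N_R$. Then the map $(\mathcal{A},R)\mapsto\Sigma_R$ is a bijection from the set of crystallographic arrangements in $V$ to the set of strongly symmetric smooth (complete) fans in $V$ (a fan being given together with its lattice).
   Context: Arrangements. A simplicial arrangement $\mathcal{A}$ in $V=\mathbb{R}^r$ is a finite set of distinct linear hyperplanes of $V$ such that every connected component (chamber) of $V\setminus\bigcup_{H\in\mathcal{A}}H$ is an open simplicial cone, i.e. of the form $\mathbb{R}_{>0}n_1+\dots+\mathbb{R}_{>0}n_r$ with linearly independent $n_i$. Let $\mathcal{K}(\mathcal{A})$ be the set of chambers; closed chambers are closures of chambers. Let $R\subseteq V^*$ be a finite set with $\mathcal{A}=\{\alpha^\perp\mid\alpha\in R\}$ ($\alpha^\perp$ = kernel of $\alpha$) and $\mathbb{R}\alpha\cap R=\{\pm\alpha\}$ for all $\alpha\in R$. For $K\in\mathcal{K}(\mathcal{A})$ let $B^K$ be the set of $\alpha\in R$ such that $\alpha\ge 0$ on $K$ and $\dim(\alpha^\perp\cap\overline{K})=r-1$. The pair $(\mathcal{A},R)$ is called a crystallographic arrangement if $R\subseteq\sum_{\alpha\in B^K}\mathbb{Z}\alpha$ for all $K\in\mathcal{K}(\mathcal{A})$. Fans. For a lattice $N\subseteq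 V$ of rank $r$, an $N$-cone is a set $\sigma=\mathbb{R}_{\ge0}n_1+\dots+\mathbb{R}_{\ge0}n_d$ with $n_i\in N$ and $\sigma\cap(-\sigma)=\{0\}$. A fan in $N$ (or in $V$, when $N$ is understood) is a nonempty collection of $N$-cones closed under taking faces and such that the intersection of any two of its cones is a face of each. It is smooth if each of its cones is generated by a subset of a $\mathbb{Z}$-basis of $N$, and complete if it is finite and its union is $V$. $\Sigma(k)$ denotes the set of $k$-dimensional cones of $\Sigma$, and the support of a set of cones is its union. A fan $\Sigma$ in $V$ is strongly symmetric if it is complete and there exist hyperplanes $H_1,\dots,H_n$ in $V$ such that the support of $\Sigma(r-1)$ equals $H_1\cup\dots\cup H_n$. *)

(* Defs.v *)
From HB Require Import structures.
From mathcomp Require Import all_boot all_order all_algebra.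
From mathcomp Require Import all_classical all_reals all_analysis.

Set Implicit Arguments.
Unset Strict Implicit.
Unset Printing Implicit Defensive.

Import Order.TTheory GRing.Theory Num.Theory.
Import numFieldNormedType.Exports.

Local Open Scope classical_set_scope.
Local Open Scope ring_scope.

(* If S is infinite the coefficient families c of infinite support contribute
   only 0, by the convention of fsbigop; so zspan S is always the subgroup
   generated by S. *)
Definition zspan (W : zmodType) (S : set W) : set W :=
  [set w | exists c : W -> int, w = \sum_(a \in S) a *~ c a].

Definition zfree (W : zmodType) (b : seq W) : Prop :=
  forall c : 'I_(size b) -> int,
    \sum_(i < size b) b`_i *~ c i = 0 -> forall i, c i = 0.

Definition is_zbasis (W : zmodType) (N : set W) (b : seq W) : Prop :=
  zfree b /\ N = zspan [set` b].

Section Fans.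
Context (R : realType) (r : nat).

Local Notation V := 'rV[R]_r.
Local Notation dualV := 'Hom('rV[R]_r, R^o).

(* Written so that nothing is a hyperplane when r = 0. *)
Definition hyperplane (H : {vspace V}) : Prop := (\dim H).+1 = r.

Definition is_lspan (S : set V) (U : {vspace V}) : Prop :=
  S `<=` [set` U] /\ forall W : {vspace V}, S `<=` [set` W] -> (U <= W)%VS.

(* Dimension of a subset (in practice, a cone) = dimension of its linear span;
   d is an integer so that r - 1 is not truncated. *)
Definition has_dim (S : set V) (d : int) : Prop :=
  exists2 U : {vspace V}, is_lspan S U & (\dim U)%:Z = d.

Definition cone (n : seq V) : set V :=
  [set v | exists2 c : 'I_(size n) -> R,
     forall i, 0 <= c i & v = \sum_(i < size n) c i *: n`_i].

Definition open_cone (n : seq V) : set V :=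
  [set v | exists2 c : 'I_(size n) -> R,
     forall i, 0 < c i & v = \sum_(i < size n) c i *: n`_i].

Definition lattice (N : set V) : Prop :=
  exists2 b : r.-tuple V, free b & N = zspan [set` b].

Definition N_cone (N : set V) (sigma : set V) : Prop :=
  (exists2 n : seq V, [set` n] `<=` N & sigma = cone n) /\
  sigma `&` [set - v | v in sigma] = [set 0].

Definition face (tau sigma : set V) : Prop :=
  exists2 u : dualV, forall v, sigma v -> 0 <= u v
                   & tau = sigma `&` [set` lker u].

Definition fan (N : set V) (Sigma : set (set V)) : Prop :=
  [/\ Sigma !=set0,
      Sigma `<=` N_cone N,
      forall sigma tau, Sigma sigma -> face tau sigma -> Sigma tau
    & forall sigma tau, Sigma sigma -> Sigma tau ->
        face (sigma `&` tau) sigma /\ face (sigma `&` tau) tau].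

Definition smooth (N : set V) (Sigma : set (set V)) : Prop :=
  forall sigma, Sigma sigma ->
    exists2 b : seq V, is_zbasis N b
      & exists2 n : seq V, {subset n <= b} & sigma = cone n.

Definition support (Sigma : set (set V)) : set V :=
  \bigcup_(sigma in Sigma) sigma.

Definition complete_fan (Sigma : set (set V)) : Prop :=
  finite_set Sigma /\ support Sigma = setT.

Definition cones_of_dim (Sigma : set (set V)) (d : int) : set (set V) :=
  Sigma `&` [set sigma | has_dim sigma d].

Definition strongly_symmetric (Sigma : set (set V)) : Prop :=
  complete_fan Sigma /\
  exists2 Hs : seq {vspace V}, forall H, H \in Hs -> hyperplane H
    & support (cones_of_dim Sigma (r%:Z - 1)) = \bigcup_(H in [set` Hs]) [set` H].

Definition strongly_symmetric_smooth_fan : set (set V * set (set V)) :=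
  [set X | [/\ lattice X.1, fan X.1 X.2, smooth X.1 X.2
             & strongly_symmetric X.2]].

Definition arr_complement (A : set {vspace V}) : set V :=
  ~` \bigcup_(H in A) [set` H].

Definition chambers (A : set {vspace V}) : set (set V) :=
  [set connected_component (arr_complement A) x | x in arr_complement A].

Definition simplicial_arrangement (A : set {vspace V}) : Prop :=
  [/\ finite_set A,
      forall H, A H -> hyperplane H
    & forall K, chambers A K ->
        exists2 n : r.-tuple V, free n & K = open_cone n].

Definition is_root_set (A : set {vspace V}) (Phi : set dualV) : Prop :=
  [/\ finite_set Phi,
      A = [set lker a | a in Phi]
    & forall a, Phi a -> [set t *: a | t in setT] `&` Phi = [set a; - a]].

Definition wall_roots (Phi : set dualV) (K : set V) : set dualV :=
  [set a | [/\ Phi a, forall v, K v -> 0 <= a v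
             & has_dim ([set` lker a] `&` closure K) (r%:Z - 1)]].

Definition crystallographic_arrangement : set (set {vspace V} * set dualV) :=
  [set X | [/\ simplicial_arrangement X.1,
               is_root_set X.1 X.2
             & forall K, chambers X.1 K ->
                 X.2 `<=` zspan (wall_roots X.2 K)]].

Definition dual_lattice (M : set dualV) : set V :=
  [set v | forall m, M m -> (m v : R) \is a Num.int].

(* The family of closed chambers intersected must be nonempty: the empty
   intersection V is not a strongly convex cone when r > 0. *)
Definition closed_chamber_intersections (A : set {vspace V}) : set (set V) :=
  [set \bigcap_(K in F) closure K
     | F in [set F | F `<=` chambers A /\ F !=set0]].

(* (A, Phi) |-> (N_Phi, Sigma_Phi): a fan is paired with its lattice. *)
Definition fan_of_arrangement (X : set {vspace V} * set dualV) :
    set V * set (set V) :=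
  (dual_lattice (zspan X.2), closed_chamber_intersections X.1).

End Fans.

(* Main.v *)
(* Chambers are the cells on which the roots have constant signs, so everything
   reduces to sign conditions in dual coordinates. For a crystallographic
   arrangement the wall roots of a chamber are a basis of the root lattice, and
   the dual basis generates both N_R and the closed chamber; faces of closed
   chambers are exactly the intersections K /\ L, where L is the chamber opposite
   to K across a relative interior point of the face. Conversely, in a strongly
   symmetric smooth fan the interiors of the maximal cones are the cells of the
   arrangement formed by the supports of the facets, and the roots must be the
   primitive normals (taking exactly the integers as values on N), which also
   shows that the roots are determined by the fan and its lattice. *)

From HB Require Import structures.
Require Import Defs.
From mathcomp Require Import all_boot all_order all_algebra.
From mathcomp Require Import all_classical all_reals all_analysis.
From mathcomp Require Import ring lra zify.

Set Implicit Arguments.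
Unset Strict Implicit.
Unset Printing Implicit Defensive.

Import Order.TTheory GRing.Theory Num.Theory.
Import numFieldNormedType.Exports.

Local Open Scope classical_set_scope.
Local Open Scope ring_scope.

(** * Linear functionals *)

(** Both directions pass through one normal form: a finite list [s] of functionals that is [charted]
    and [rooted]. In a chart a single basis [m] serves the cone and the lattice: its dual basis lies
    in [s] and all of [s] is integral on it, so [m] generates the closed cell over the nonnegative
    reals and the dual lattice over the integers. Generators of a simplicial chamber are determined
    only up to positive factors; wall roots fix these factors on the way to the fan, primitivity
    fixes the scale of the roots on the way back. The geometry rests on general position: a convex
    cone contained in none of finitely many hyperplanes has a point off all of them, and a short
    push keeps nonzero signs. Such pushes find a chamber next to a wall or opposite across a face,
    and show that full-dimensional cones cover. Topology serves only to identify components and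
    closures with sign conditions. *)

Section Functionals.
Context (R : realType) (r : nat).
Local Notation V := 'rV[R]_r.
Local Notation dualV := 'Hom('rV[R]_r, R^o).

(* The value is cast from [R^o] back to [R] so that [lra] and [nra] apply. *)
Definition ev (a : dualV) (v : V) : R := a v.

Lemma evD a v w : ev a (v + w) = ev a v + ev a w.
Proof. exact: linearD. Qed.
Lemma evZ a k v : ev a (k *: v) = k * ev a v.
Proof. exact: linearZ. Qed.
Lemma evN a v : ev a (- v) = - ev a v.
Proof. exact: linearN. Qed.
Lemma ev0 a : ev a 0 = 0.
Proof. exact: linear0. Qed.
Lemma ev_sum a I (t : seq I) (P : pred I) F :
  ev a (\sum_(i <- t | P i) F i) = \sum_(i <- t | P i) ev a (F i).
Proof. exact: linear_sum. Qed.
Lemma evZl k a v : ev (k *: a) v = k * ev a v.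
Proof. by rewrite /ev scale_lfunE. Qed.
Lemma evNl a v : ev (- a) v = - ev a v.
Proof. by rewrite /ev opp_lfunE. Qed.
Lemma evDl a b v : ev (a + b) v = ev a v + ev b v.
Proof. by rewrite /ev add_lfunE. Qed.
Lemma ev_suml I (t : seq I) (P : pred I) (F : I -> dualV) v :
  ev (\sum_(i <- t | P i) F i) v = \sum_(i <- t | P i) ev (F i) v.
Proof. by rewrite /ev sum_lfunE. Qed.
Lemma evMz k a v : ev (a *~ k) v = ev a v * k%:~R.
Proof.
have zn n : ev (a *+ n) v = ev a v * n%:R.
  elim: n => [|n IH]; first by rewrite mulr0n /ev zero_lfunE mulr0.
  by rewrite mulrS evDl IH mulrS mulrDr mulr1.
case: k => n; first exact: zn.
by rewrite NegzE !mulrNz evNl zn mulrN.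
Qed.

Lemma mem_lkerE a v : (v \in lker a) = (ev a v == 0).
Proof. exact: memv_ker. Qed.

Lemma in_lker a v : [set` lker a] v <-> ev a v = 0.
Proof. by rewrite /= mem_lkerE; split => [/eqP|->]. Qed.

Lemma ev_eqP a b : ev a =1 ev b <-> a = b.
Proof. by split => [h|-> //]; apply/lfunP. Qed.

Lemma ev_neq0 (a : dualV) : a != 0 -> exists v, ev a v != 0.
Proof.
move=> a0; apply: contrapT => h; case/eqP: a0; apply/ev_eqP => v.
rewrite {2}/ev zero_lfunE; apply: contrapT => /eqP e; apply: h; by exists v.
Qed.

Lemma dim_lker (a : dualV) : a != 0 -> (\dim (lker a)).+1 = r.
Proof.
move=> /ev_neq0[v av].
have := limg_ker_dim a fullv.
rewrite capfv dimvf /dim /= mul1n => h.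
rewrite -[RHS]h -addn1; congr (_ + _)%N.
suff -> : (limg a) = fullv by rewrite dimvf.
apply/vspaceP => y.
rewrite memvf; apply/memv_imgP; exists ((y / ev a v) *: v); rewrite ?memvf //.
by rewrite -/(ev _ _) evZ mulfVK.
Qed.

Lemma lker_sub_eq (a b : dualV) : a != 0 -> b != 0 ->
  (forall v, ev a v = 0 -> ev b v = 0) -> lker a = lker b.
Proof.
move=> a0 b0 h; apply/eqP; rewrite eqEdim; apply/andP; split.
  by apply/subvP => v; rewrite !mem_lkerE => /eqP /h ->.
have [<-] := etrans (dim_lker a0) (esym (dim_lker b0)); exact: leqnn.
Qed.

Lemma lker_prop (a b : dualV) v : lker a = lker b -> ev b v != 0 ->
  a = (ev a v / ev b v) *: b.
Proof.
move=> e bv; apply/ev_eqP => w; rewrite evZl.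
have : w - (ev b w / ev b v) *: v \in lker a.
  by rewrite e mem_lkerE evD evN evZ mulfVK // subrr.
rewrite mem_lkerE evD evN evZ subr_eq0 => /eqP ->; field.
exact: bv.
Qed.

Lemma continuous_ev a : continuous (ev a).
Proof.
have e v : ev a v = \sum_(i < r) v 0 i * ev a (delta_mx 0 i).
  rewrite {1}(row_sum_delta v) ev_sum; apply: eq_bigr => i _; exact: evZ.
have -> : ev a = fun v => \sum_(i < r) v 0 i * ev a (delta_mx 0 i).
  by apply/funext.
elim: (index_enum _) => [|i t IH].
  have -> : (fun v : V => \sum_(i <- [::]) v 0 i * ev a (delta_mx 0 i)) = cst 0.
    by apply/funext => v; rewrite big_nil.
  exact: cst_continuous.
have -> : (fun v : V => \sum_(j <- i :: t) v 0 j * ev a (delta_mx 0 j)) =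
    fun v : V => v 0 i * ev a (delta_mx 0 i)
             + \sum_(j <- t) v 0 j * ev a (delta_mx 0 j).
  by apply/funext => v; rewrite big_cons.
have d : continuous (fun v : V => v 0 i) by exact: (@coord_continuous R 1 r 0 i).
move=> v; apply: (@continuousD R R^o V); last exact: IH.
apply: (@continuousM R V); first exact: d.
exact: (@cst_continuous V R).
Qed.

End Functionals.

(** * Sign cells of an arrangement *)
Section Cells.
Context (R : realType) (r : nat).
Local Notation V := 'rV[R]_r.
Local Notation dualV := 'Hom('rV[R]_r, R^o).
Implicit Types (a b : dualV) (x y v w : V) (s : seq dualV).

Definition regular s x := forall a, a \in s -> ev a x != 0.
(** Equality of signs is encoded by a positive product, which postpones case splits on the sign at
    [x]. The reading is meant for regular [x]: a root vanishing at [x] makes [cell] empty and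
    imposes nothing on [closed_cell]. *)
Definition cell s x : set V := [set y | forall a, a \in s -> 0 < ev a x * ev a y].
Definition closed_cell s x : set V :=
  [set y | forall a, a \in s -> 0 <= ev a x * ev a y].
Definition arrangement s : set {vspace V} := [set lker a | a in [set` s]].

Lemma cell_refl s x : regular s x -> cell s x x.
Proof.
by move=> h a /h ax; rewrite -expr2 exprn_even_gt0.
Qed.

Lemma perturbation s x y : exists2 e0 : R, 0 < e0 & forall e, 0 < e -> e <= e0 ->
  forall a, a \in s -> ev a x != 0 -> 0 < ev a x * ev a (x + e *: y).
Proof.
elim: s => [|a s [e1 e1p IH]]; first by exists 1.
(* The summand 1 keeps the denominator positive when [ev a y] is 0; the factor 1/2 makes the change
   [e * ev a y] strictly smaller than [ev a x] in absolute value. *)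
pose e2 := `|ev a x| / (1 + `|ev a y|) / 2.
have [ax|ax] := eqVneq (ev a x) 0.
  exists e1 => // e ep el b; rewrite inE => /orP[/eqP ->|]; first by rewrite ax eqxx.
  exact: IH.
have e2p : 0 < e2 by rewrite /e2 !divr_gt0 ?normr_gt0 // ltr_wpDr.
exists (Num.min e1 e2); first by rewrite lt_min e1p.
move=> e ep; rewrite le_min => /andP[l1 l2] b; rewrite inE => /orP[/eqP ->|]; last exact: IH.
move=> _; rewrite evD evZ mulrDr.
have yp : 0 < 1 + `|ev a y| by rewrite ltr_wpDr.
have h : e * (1 + `|ev a y|) <= `|ev a x| / 2.
  have -> : `|ev a x| / 2 = e2 * (1 + `|ev a y|) by rewrite /e2; field; rewrite lt0r_neq0.
  by rewrite ler_pM2r.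
have xp : 0 < `|ev a x| by rewrite normr_gt0.
have h1 : e * `|ev a y| < `|ev a x| by nra.
have : `|ev a x * (e * ev a y)| < `|ev a x| * `|ev a x|.
  by rewrite !normrM (gtr0_norm ep) ltr_pM2l.
rewrite -normrM ltr_norml => /andP[+ _].
have -> : `|ev a x * ev a x| = ev a x * ev a x by rewrite ger0_norm // -expr2 sqr_ge0.
lra.
Qed.

(** Induction on [s]: from a point generic for the tail, a short push towards a point of [C] off the
    new hyperplane leaves that hyperplane and keeps all earlier signs. The closure condition holds
    both for subspaces and for simplicial cones. *)
Lemma generic_point (C : set V) s : C !=set0 ->
  (forall x y e, C x -> C y -> 0 < e -> C (x + e *: y)) ->
  (forall a, a \in s -> exists2 y, C y & ev a y != 0) ->
  exists2 x, C x & regular s x.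
Proof.
move=> [x0 Cx0] cC; elim: s => [|a s IH] h; first by exists x0.
have [|x Cx rx] := IH; first by move=> b bs; apply: h; rewrite inE bs orbT.
have [ax|ax] := eqVneq (ev a x) 0; last first.
  by exists x => // b; rewrite inE => /orP[/eqP ->|/rx].
have [|y Cy ay] := h a; first by rewrite inE eqxx.
have [e ep he] := perturbation s x y.
exists (x + e *: y); first exact: cC.
move=> b; rewrite inE => /orP[/eqP ->|bs].
  by rewrite evD evZ ax add0r mulf_neq0 // lt0r_neq0.
have := he e ep (lexx e) b bs (rx b bs).
by apply: contraTneq => ->; rewrite mulr0 ltxx.
Qed.

Lemma regular_exists s : (forall a, a \in s -> a != 0) -> exists x, regular s x.
Proof.
move=> h; have [||a|x _] := @generic_point setT s; [by exists 0|by []| |by exists x].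
by move=> /h /ev_neq0[v av]; exists v.
Qed.

(** A functional with another kernel cannot vanish on all of [lker a], because two kernels of equal
    dimension that are nested coincide. *)
Lemma generic_on_lker s a : a != 0 -> (forall b, b \in s -> b != 0) ->
  exists2 y, ev a y = 0 & forall b, b \in s -> lker a != lker b -> ev b y != 0.
Proof.
move=> a0 s0; have [||b|y ya ry] :=
  @generic_point [set` lker a] [seq b <- s | lker a != lker b].
- by exists 0; rewrite /= mem0v.
- by move=> x y e /= xa ya _; rewrite memvD // memvZ.
- rewrite mem_filter => /andP[ab bs]; apply: contrapT => h.
  case/eqP: ab; apply: lker_sub_eq => // [|v av]; first exact: s0.
  by apply: contrapT => /eqP bv; apply: h; exists v => //; exact/in_lker.
exists y; first exact/in_lker.
by move=> b bs ab; apply: ry; rewrite mem_filter ab.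
Qed.

(** Roots vanishing at [y] take the sign of [z], the others keep their sign at [y]. The explicit
    form of [x] records on which side of [y] the chamber lies. *)
Lemma regular_near s y z : regular s z ->
  exists x, [/\ regular s x, closed_cell s x y &
     exists2 e, 0 < e & x = y + e *: z].
Proof.
move=> rz; have [e ep he] := perturbation s y z; exists (y + e *: z); split.
- move=> a as_; have [ay|ay] := eqVneq (ev a y) 0.
    by rewrite evD evZ ay add0r mulf_neq0 ?rz // lt0r_neq0.
  by have := he e ep (lexx e) a as_ ay; apply: contraTneq => ->; rewrite mulr0 ltxx.
- move=> a as_; have [ay|ay] := eqVneq (ev a y) 0; first by rewrite ay mulr0.
  by rewrite mulrC ltW // he.
- by exists e.
Qed.

(** Otherwise [C] would contain a regular point, which the union misses. *)
Lemma cone_in_union (C : set V) s : C !=set0 ->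
  (forall x y e, C x -> C y -> 0 < e -> C (x + e *: y)) ->
  C `<=` \bigcup_(H in arrangement s) [set` H] ->
  exists2 a, a \in s & C `<=` [set` lker a].
Proof.
move=> C0 cC sub; apply: contrapT => nh.
have [||a as_|x /sub[_ [a /= as_ <-]]] := @generic_point C s; [by []|by []| |].
  apply: contrapT => nv; apply: nh; exists a => // x Cx.
  by apply/in_lker; apply: contrapT => /eqP ax; apply: nv; exists x.
by move=> /= xa /(_ a as_); rewrite (_ : ev a x = 0) ?eqxx //; apply/in_lker.
Qed.

Lemma arr_complementE s : arr_complement (arrangement s) = [set x | regular s x].
Proof.
apply/seteqP; split => x.
  move=> h a as_; apply: contraPneq h => ax; apply: contrapT => /contrapT h.
  by apply: h; exists (lker a); [exists a|exact/in_lker].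
move=> rx [_ [a /= as_ <-]] xa; have := rx _ as_.
by rewrite (_ : ev a x = 0) ?eqxx //; apply/in_lker.
Qed.

Lemma segment_continuous x w : continuous (fun t : R => x + t *: w).
Proof.
move=> t; apply: (@continuousD R V R); first exact: cst_continuous.
apply: (@continuousZr_tmp R V R); exact: cvg_id.
Qed.

(** On a connected subset of the complement each root has an interval of values avoiding 0, hence a
    constant sign; conversely a segment between two points of a cell stays in it. *)
Lemma chamber_cell s x : regular s x ->
  connected_component (arr_complement (arrangement s)) x = cell s x.
Proof.
move=> rx; rewrite arr_complementE; apply/seteqP; split => y.
  move=> [C [Cx Cs cC] Cy] a as_.
  have cI : is_interval (ev a @` C).
    apply/connected_intervalP/connected_continuous_connected => //.
    by apply: continuous_subspaceT; exact: continuous_ev.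
  have ax : ev a x != 0 by exact: Cs.
  have ay : ev a y != 0 by exact: (Cs y).
  have n0 : ~ (ev a @` C) 0 by move=> [z /Cs/(_ a as_)/eqP].
  have [//|le0] := ltP 0 (ev a x * ev a y); exfalso; apply: n0.
  have Ix : (ev a @` C) (ev a x) by exists x.
  have Iy : (ev a @` C) (ev a y) by exists y.
  have [xp|xn] := ltP 0 (ev a x).
    apply: (cI (ev a y) (ev a x)) => //; apply/andP; split; nra.
  apply: (cI (ev a x) (ev a y)) => //; apply/andP; split=> //.
  by move: ax; rewrite neq_lt => /orP[]; nra.
move=> xy; exists ((fun t : R => x + t *: (y - x)) @` `[0, 1]); last first.
  exists 1; first by rewrite /= in_itv /= ler01 lexx.
  by rewrite scale1r addrC subrK.
split.
- exists 0; first by rewrite /= in_itv /= ler01 lexx.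
  by rewrite scale0r addr0.
- move=> _ [t + <-] a as_; rewrite /= in_itv /= => /andP[t0 t1].
  have := xy a as_; have := cell_refl rx as_; rewrite evD evZ evD evN.
  set p := ev a x; set q := ev a y => pp pq.
  have : 0 < p * (p + t * (q - p)).
    have -> : p * (p + t * (q - p)) = (1 - t) * (p * p) + t * (p * q) by ring.
    have [->|t1'] := eqVneq t 1; first by lra.
    apply: ltr_pwDl; last by rewrite mulr_ge0 // ltW.
    by apply: mulr_gt0 => //; rewrite subr_gt0 lt_neqAle t1'.
  by apply: contraTneq => ->; rewrite mulr0 ltxx.
- apply: connected_continuous_connected; first exact: segment_connected.
  by apply: continuous_subspaceT; exact: segment_continuous.
Qed.

Lemma chambersE s : chambers (arrangement s) = [set cell s x | x in [set x | regular s x]].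
Proof.
rewrite /chambers arr_complementE.
by apply/seteqP; split => _ [x rx <-]; exists x => //;
  rewrite -arr_complementE chamber_cell.
Qed.

(** A strictly wrong sign at [v] persists near [v]; conversely [v + t *: x] lies in the cell for
    every [t > 0] and tends to [v]. *)
Lemma closure_cell s x : regular s x -> closure (cell s x) = closed_cell s x.
Proof.
move=> rx; apply/seteqP; split => v.
  move=> cv a as_; have [//|lt0] := leP 0 (ev a x * ev a v); exfalso.
  have : nbhs v [set w | ev a x * ev a w < 0].
    have c : {for v, continuous (cst (ev a x) \* ev a)}.
      by apply: (@continuousM R V); [exact: cst_continuous|exact: continuous_ev].
    have o : nbhs ((cst (ev a x) \* ev a) v) [set t : R | t < 0].
      by apply: open_nbhs_nbhs; split => //; exact: open_lt.
    exact: c _ o.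
  by move=> /cv[w [/(_ a as_) xw /=]]; rewrite ltNge ltW.
move=> vx B nB.
have : nbhs (0 : R) ((fun t : R => v + t *: x) @^-1` B).
  by apply: (segment_continuous); rewrite scale0r addr0.
move=> /nbhs_ballP[e /= ep eB]; exists (v + (e / 2) *: x); split; last first.
  by apply: eB; rewrite /ball /= sub0r normrN gtr0_norm; lra.
move=> a as_; rewrite evD evZ; have := vx a as_; have := cell_refl rx as_.
have : 0 < e / 2 by rewrite divr_gt0.
move: (e / 2) (ev a x) (ev a v) => k p q kp pp pq; nra.
Qed.

(** Expresses the closed cell through the open one without topology, so that any other description
    of the open cell carries over to its closure. *)
Lemma cell_dir s x v : regular s x ->
  closed_cell s x v <-> forall e, 0 < e -> cell s x (v + e *: x).
Proof.
move=> rx; split => [h e ep a as_|h a as_].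
  have := h a as_; have := cell_refl rx as_; rewrite evD evZ; nra.
have [//|lt0] := leP 0 (ev a x * ev a v); exfalso.
have xx := cell_refl rx as_.
(* The value of [e] at which [a] vanishes on [v + e *: x]. *)
pose e := - (ev a x * ev a v) / (ev a x * ev a x).
have ep : 0 < e by rewrite divr_gt0 // oppr_gt0.
have := h e ep a as_; rewrite evD evZ mulrDr.
have -> : ev a x * (e * ev a x) = - (ev a x * ev a v).
  by rewrite /e; field; exact: rx.
by rewrite subrr ltxx.
Qed.

End Cells.

(** * Lattices and simplicial cones *)
Section IntegerSpans.
Context (W : zmodType).
Implicit Types (S : set W) (t : seq W).

Lemma zspan_seqP t w : uniq t ->
  zspan [set` t] w <-> exists c : W -> int, w = \sum_(a <- t) a *~ c a.
Proof.
move=> ut; split => -[c ->]; exists c; first by rewrite -fsbig_seq.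
exact: fsbig_seq.
Qed.

Lemma finite_uniq_seq S : finite_set S -> exists2 t, uniq t & S = [set` t].
Proof.
move=> /finite_seqP[t ->]; exists (undup t); first exact: undup_uniq.
by apply/seteqP; split => x /=; rewrite mem_undup.
Qed.

Lemma zspan_ind S (G : set W) : finite_set S -> G 0 ->
  (forall a b, G a -> G b -> G (a + b)) ->
  (forall a k, S a -> G (a *~ k)) -> zspan S `<=` G.
Proof.
move=> /finite_uniq_seq[t ut ->] G0 GD Gk w /(zspan_seqP _ ut)[c ->].
rewrite big_seq; apply: big_ind => // a at_; exact: Gk.
Qed.

Lemma zspan0 S : finite_set S -> zspan S 0.
Proof.
move=> /finite_uniq_seq[t ut ->]; apply/(zspan_seqP _ ut); exists (fun=> 0).
by rewrite big1.
Qed.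

Lemma zspanD S a b : finite_set S -> zspan S a -> zspan S b -> zspan S (a + b).
Proof.
move=> /finite_uniq_seq[t ut ->] /(zspan_seqP _ ut)[c ->] /(zspan_seqP _ ut)[d ->].
apply/(zspan_seqP _ ut); exists (fun a => c a + d a).
by rewrite -big_split; apply: eq_bigr => i _; rewrite mulrzDr.
Qed.

Lemma zspanM S a k : finite_set S -> S a -> zspan S (a *~ k).
Proof.
move=> /finite_uniq_seq[t ut ->] at_; apply/(zspan_seqP _ ut).
exists (fun b => if b == a then k else 0).
by rewrite (bigD1_seq a) //= eqxx big1 ?addr0 // => b /negPf ->.
Qed.

Lemma zspan_mem S a : finite_set S -> S a -> zspan S a.
Proof. by move=> fS Sa; have := @zspanM S a 1 fS Sa. Qed.

Lemma zspan_sum S n (f : 'I_n -> W) (c : 'I_n -> int) : finite_set S ->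
  (forall i, S (f i)) -> zspan S (\sum_i f i *~ c i).
Proof.
move=> fS Sf; apply: (big_ind (zspan S)); first exact: zspan0.
- by move=> a b; exact: zspanD.
- by move=> i _; exact: zspanM.
Qed.

End IntegerSpans.

(** * Dual bases, faces of simplicial cones, and lattice bases *)

Section Bases.
Context (R : realType) (r : nat).
Local Notation V := 'rV[R]_r.
Local Notation dualV := 'Hom('rV[R]_r, R^o).
Implicit Types (a b u : dualV) (x y v w : V) (m : r.-tuple V) (J : {set 'I_r}).

Definition dual m i : dualV := linfun (coord m i : V -> R^o).

Lemma ev_dual m i v : ev (dual m i) v = coord m i v.
Proof. by rewrite /ev /dual lfunE. Qed.

Lemma dual_basis m (i j : 'I_r) : free m -> ev (dual m i) m`_j = (i == j)%:R.
Proof. by move=> fm; rewrite ev_dual coord_free // eq_sym. Qed.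

Lemma dual_sum m i (c : 'I_r -> R) : free m ->
  ev (dual m i) (\sum_j c j *: m`_j) = c i.
Proof. by move=> fm; rewrite ev_dual coord_sum_free. Qed.

Lemma dual_expand m v : free m -> v = \sum_i ev (dual m i) v *: m`_i.
Proof.
move=> fm; have h : v \in <<m>>%VS.
  have -> : <<m>>%VS = fullv; last exact: memvf.
  apply/eqP; rewrite eqEdim subvf dimvf /dim /= mul1n.
  by move: fm; rewrite /free => /eqP ->; rewrite size_tuple leqnn.
rewrite {1}(coord_span h); apply: eq_bigr => i _; by rewrite ev_dual.
Qed.

Lemma dual_ev m a v : free m -> ev a v = \sum_i ev (dual m i) v * ev a m`_i.
Proof.
by move=> fm; rewrite {1}(dual_expand v fm) ev_sum; apply: eq_bigr => i _; rewrite evZ.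
Qed.

Lemma dual_neq0 m i : free m -> dual m i != 0.
Proof.
move=> fm; apply/eqP => e; have := dual_basis i i fm; rewrite eqxx e /ev zero_lfunE.
by move/eqP; rewrite eq_sym oner_eq0.
Qed.

Lemma free_of_dual m (f : 'I_r -> dualV) :
  (forall i j : 'I_r, ev (f i) m`_j = (i == j)%:R) -> free m.
Proof.
move=> h; apply/freeP => k /= k0 i; have := congr1 (ev (f i)) k0.
rewrite ev0 ev_sum (bigD1 i) //= evZ h eqxx mulr1 big1 ?addr0 // => j ji.
by rewrite evZ h eq_sym (negPf ji) mulr0.
Qed.

Lemma dual_unique m i a : free m -> (forall j : 'I_r, ev a m`_j = (i == j)%:R) ->
  a = dual m i.
Proof.
move=> fm h; apply/ev_eqP => v; rewrite (dual_ev a v fm) (bigD1 i) //= h eqxx mulr1.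
by rewrite big1 ?addr0 // => j ji; rewrite h eq_sym (negPf ji) mulr0.
Qed.

Lemma dual_decomp m a : free m -> a = \sum_(i < r) ev a m`_i *: dual m i.
Proof.
move=> fm; apply/ev_eqP => v; rewrite (dual_ev a v fm) ev_suml.
by apply: eq_bigr => i _; rewrite evZl mulrC.
Qed.

Lemma nth_tuple_mem m (i : 'I_r) : m`_i \in tval m.
Proof. by apply: mem_nth; rewrite size_tuple. Qed.

Lemma mem_tuple_nth m v : v \in tval m -> exists i : 'I_r, v = m`_i.
Proof.
move=> /(nthP 0)[i]; rewrite size_tuple => ir <-; by exists (Ordinal ir).
Qed.

Lemma nth_free_inj m (i j : 'I_r) : free m -> m`_i = m`_j -> i = j.
Proof.
move=> fm e; have := dual_basis i j fm; rewrite -e dual_basis // eqxx.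
by case: eqP => // _ /eqP; rewrite oner_eq0.
Qed.

(* For free [m], the cone generated by the [m`_i] with [i \in J], written in dual
   coordinates. *)
Definition simplex_cone m J : set V :=
  [set v | forall i, 0 <= ev (dual m i) v /\ (i \notin J -> ev (dual m i) v = 0)].

Lemma cone0 (n : seq V) : cone n 0.
Proof. by exists (fun=> 0) => //; rewrite big1 // => i _; rewrite scale0r. Qed.

Lemma coneD (n : seq V) v w : cone n v -> cone n w -> cone n (v + w).
Proof.
move=> [c c0 ->] [d d0 ->]; exists (fun i => c i + d i); first by move=> i; rewrite addr_ge0.
by rewrite -big_split; apply: eq_bigr => i _; rewrite scalerDl.
Qed.

Lemma cone_gen (n : seq V) v (k : R) : v \in n -> 0 <= k -> cone n (k *: v).
Proof.
move=> vn k0; have ni : (index v n < size n)%N by rewrite index_mem.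
exists (fun i => if i == Ordinal ni then k else 0); first by move=> i; case: ifP.
rewrite (bigD1 (Ordinal ni)) //= eqxx nth_index // big1 ?addr0 //.
by move=> i /negPf ->; rewrite scale0r.
Qed.

(** Generators may repeat and come in any order in [n]; dual coordinates only record which vectors
    of [m] occur. *)
Lemma cone_simplex m (n : seq V) : free m -> {subset n <= tval m} ->
  cone n = simplex_cone m [set i : 'I_r | m`_i \in n].
Proof.
move=> fm nm; apply/seteqP; split => v.
  move=> [c c0 ->] i; rewrite ev_sum; split.
    apply: sumr_ge0 => j _; rewrite evZ mulr_ge0 //.
    have /nm/mem_tuple_nth[k ->] : n`_j \in n by exact: mem_nth.
    by rewrite dual_basis // ler0n.
  rewrite inE => ni; apply: big1 => j _; rewrite evZ.
  have jn : n`_j \in n by exact: mem_nth.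
  have /nm/mem_tuple_nth[k ek] := jn; rewrite ek dual_basis //.
  case: eqP => [ik|]; last by rewrite mulr0.
  by move: ni; rewrite ik -ek jn.
move=> h; rewrite (dual_expand v fm); apply: (big_ind (cone n)).
- exact: cone0.
- by move=> ? ?; exact: coneD.
move=> i _; have [p q] := h i.
have [iJ|iJ] := boolP (m`_i \in n); first exact: cone_gen.
by rewrite q ?inE // scale0r; exact: cone0.
Qed.

Lemma open_cone_dual m : free m ->
  open_cone m = [set v | forall i, 0 < ev (dual m i) v].
Proof.
move=> fm; apply/seteqP; split => v; rewrite /open_cone /=.
  move=> [c c0 ->] i.
  have ei : (i < size m)%N by rewrite size_tuple.
  have -> : \sum_(j < size m) c j *: m`_j =
     \sum_j (fun j : 'I_r => c (cast_ord (esym (size_tuple m)) j)) j *: m`_j.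
    by rewrite (reindex (cast_ord (esym (size_tuple m)))) //;
       apply: onW_bij; exists (cast_ord (size_tuple m)) => j; apply: val_inj.
  by rewrite dual_sum.
move=> h; exists (fun j => ev (dual m (cast_ord (size_tuple m) j)) v); first by move=> j.
rewrite {1}(dual_expand v fm) (reindex (cast_ord (size_tuple m))) //.
by apply: onW_bij; exists (cast_ord (esym (size_tuple m))) => j; apply: val_inj.
Qed.

Lemma simplex_cone_gens m J : free m ->
  simplex_cone m J = cone [seq m`_i | i : 'I_r <- enum J].
Proof.
move=> fm; rewrite (@cone_simplex m) //; last first.
  by move=> _ /mapP[i _ ->]; exact: nth_tuple_mem.
congr simplex_cone; apply/setP => i; rewrite inE.
apply/idP/mapP => [iJ|[j]]; first by exists i; rewrite ?mem_enum.
by rewrite mem_enum => jJ /(nth_free_inj fm) ->.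
Qed.

Lemma simplex_cone_nth m J (i : 'I_r) : free m -> i \in J -> simplex_cone m J m`_i.
Proof.
move=> fm iJ j; rewrite dual_basis // ler0n; split => //.
by case: eqP => // ->; rewrite iJ.
Qed.

Lemma simplex_coneD m J v w (e : R) : 0 <= e ->
  simplex_cone m J v -> simplex_cone m J w -> simplex_cone m J (v + e *: w).
Proof.
move=> e0 h h' i; have [p q] := h i; have [p' q'] := h' i; rewrite evD evZ; split.
  by rewrite addr_ge0 // mulr_ge0.
by move=> iJ; rewrite q // q' // mulr0 addr0.
Qed.

Lemma free_nth_enum m J : free m -> free [seq m`_i | i : 'I_r <- enum J].
Proof.
move=> fm; have e : perm_eq (enum J ++ enum (~: J)) (enum 'I_r).
  apply: uniq_perm; rewrite ?enum_uniq //.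
    rewrite cat_uniq !enum_uniq andbT /=; apply/hasPn => i.
    by rewrite !mem_enum inE.
  by move=> i; rewrite mem_cat !mem_enum !inE orbN.
have := perm_map (fun i : 'I_r => m`_i) e; rewrite map_cat => /perm_free h.
have em : [seq m`_i | i : 'I_r <- enum 'I_r] = m.
  apply: (@eq_from_nth _ 0); first by rewrite size_map size_enum_ord size_tuple.
  move=> i; rewrite size_map size_enum_ord => ir.
  by rewrite (nth_map (Ordinal ir)) ?size_enum_ord // nth_enum_ord.
by move: h; rewrite em fm; exact: catl_free.
Qed.

Lemma is_lspan_unique (S : set V) U1 U2 : is_lspan S U1 -> is_lspan S U2 -> U1 = U2.
Proof.
by move=> [s1 m1] [s2 m2]; apply/eqP; rewrite eqEsubv; rewrite m1 // m2.
Qed.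

Lemma simplex_cone_lspan m J : free m ->
  is_lspan (simplex_cone m J) <<[seq m`_i | i : 'I_r <- enum J]>>%VS.
Proof.
move=> fm; split.
  move=> v h /=; rewrite (dual_expand v fm); apply: memv_suml => i _.
  have [iJ|/(proj2 (h i)) ->] := boolP (i \in J); last by rewrite scale0r mem0v.
  by apply/memvZ/memv_span/map_f; rewrite mem_enum.
move=> U sub; apply/span_subvP => v /mapP[i]; rewrite mem_enum => iJ ->.
exact: (sub _ (simplex_cone_nth fm iJ)).
Qed.

Lemma has_dim_simplex m J (d : int) : free m ->
  has_dim (simplex_cone m J) d <-> d = #|J|%:Z.
Proof.
move=> fm; have L := simplex_cone_lspan J fm.
have e : \dim <<[seq m`_i | i : 'I_r <- enum J]>> = #|J|.
  by have := free_nth_enum J fm; rewrite /free => /eqP ->; rewrite size_map -cardE.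
split => [[U /is_lspan_unique /(_ L) -> <-]|->]; first by rewrite e.
by exists <<[seq m`_i | i : 'I_r <- enum J]>>%VS => //; rewrite e.
Qed.

Lemma simplex_cone_sub m (J J' : {set 'I_r}) : free m ->
  simplex_cone m J `<=` simplex_cone m J' -> J \subset J'.
Proof.
move=> fm h; apply/fintype.subsetP => i iJ; have := h _ (simplex_cone_nth fm iJ) i.
by rewrite dual_basis // eqxx => -[_]; case: (i \in J') => // /(_ isT)/eqP;
  rewrite oner_eq0.
Qed.

(** On the cone [u] is a sum of nonnegative terms, one per generator, so it vanishes only where
    every term does: the face is spanned by the generators killed by [u]. *)
Lemma face_simplex m J (tau : set V) : free m -> face tau (simplex_cone m J) ->
  exists2 J' : {set 'I_r}, J' \subset J & tau = simplex_cone m J'.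
Proof.
move=> fm [u u0 ->].
have ui i : i \in J -> 0 <= ev u m`_i by move=> iJ; apply/u0/simplex_cone_nth.
exists [set i : 'I_r in J | ev u m`_i == 0].
  by apply/fintype.subsetP => i; rewrite inE => /andP[].
apply/seteqP; split => v.
  move=> [h /in_lker uv] i; have [p q] := h i; split => //.
  rewrite inE negb_and => /orP[/q //|ni].
  have [iJ|/q//] := boolP (i \in J).
  move: uv; rewrite (dual_ev _ _ fm) => /eqP.
  rewrite psumr_eq0; last first.
    move=> j _; have [p' q'] := h j; have [jJ|/q' ->] := boolP (j \in J).
      by rewrite mulr_ge0 // ui.
    by rewrite mul0r.
  by move=> /allP/(_ i (mem_index_enum _)); rewrite mulf_eq0 (negPf ni) orbF => /eqP.
move=> h; split.
  move=> i; have [p q] := h i; split => // ni; apply: q; rewrite inE negb_and ni //.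
apply/in_lker; rewrite (dual_ev _ _ fm) big1 // => i _.
have [p q] := h i.
have [/[!inE]/andP[_ /eqP ->]|/q ->] := boolP (i \in [set i : 'I_r in J | ev u m`_i == 0]).
  by rewrite mulr0.
by rewrite mul0r.
Qed.

Lemma simplex_face m (J J' : {set 'I_r}) : free m -> J' \subset J ->
  face (simplex_cone m J') (simplex_cone m J).
Proof.
move=> fm sJ; have e v : ev (\sum_(i | i \notin J') dual m i) v =
    \sum_(i | i \notin J') ev (dual m i) v by rewrite ev_suml.
(* The sum of the coordinates to be killed is nonnegative on the cone and is zero only when each of
   them is. *)
exists (\sum_(i | i \notin J') dual m i).
  by move=> v h; rewrite -/(ev _ v) e sumr_ge0 // => i _; have [] := h i.
apply/seteqP; split => v.
  move=> h; split; last first.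
    by apply/in_lker; rewrite e big1 // => i; have [_] := h i.
  move=> i; have [p q] := h i; split=> // iJ; apply: q.
  by apply: contra iJ; exact: (fintype.subsetP sJ).
move=> [h /in_lker /eqP]; rewrite e psumr_eq0; last by move=> i _; have [] := h i.
move=> /allP hv i; have [p q] := h i; split => // iJ.
by have /implyP/(_ iJ)/eqP := hv i (mem_index_enum _).
Qed.

Lemma N_cone_simplex m J (N : set V) : free m -> [set` tval m] `<=` N ->
  N_cone N (simplex_cone m J).
Proof.
move=> fm mN; split.
  exists [seq m`_i | i : 'I_r <- enum J]; last exact: simplex_cone_gens.
  by move=> _ /= /mapP[i _ ->]; apply: mN; exact: nth_tuple_mem.
apply/seteqP; split => v /=.
  move=> [h [w h' vw]]; rewrite (dual_expand v fm) big1 // => i _.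
  have [p _] := h i; have [p' _] := h' i.
  suff -> : ev (dual m i) v = 0 by rewrite scale0r.
  by move: p; rewrite -vw evN; lra.
move=> ->; split; first by move=> i; rewrite ev0.
by exists 0; [move=> i; rewrite ev0|rewrite oppr0].
Qed.

Lemma zspan_free m v : free m ->
  zspan [set` tval m] v <-> forall i, ev (dual m i) v \is a Num.int.
Proof.
move=> fm; split.
  have fs : finite_set [set` tval m] by exact: finite_seq.
  move: v; apply: (zspan_ind fs).
  - by move=> i; rewrite ev0 rpred0.
  - by move=> v w h h' i; rewrite evD rpredD.
  - move=> v k /= /mem_tuple_nth[j ->] i.
    by rewrite -scaler_int evZ dual_basis // rpredM // ?natr_int // intr_int.
move=> h; have /choice[c hc] : forall i, exists k : int, ev (dual m i) v = k%:~R.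
  by move=> i; exact/intrP.
rewrite (dual_expand v fm).
have -> : \sum_i ev (dual m i) v *: m`_i = \sum_(i < r) m`_i *~ c i.
  by apply: eq_bigr => i _; rewrite hc scaler_int.
apply: zspan_sum; first exact: finite_seq.
by move=> i; exact: nth_tuple_mem.
Qed.

Lemma zbasis_free m : free m -> is_zbasis (zspan [set` tval m]) m.
Proof.
move=> fm; split => // c h i.
have lt_r k : (k < size m)%N -> (k < r)%N by rewrite size_tuple.
have ir := lt_r _ (ltn_ord i).
have := congr1 (ev (dual m (Ordinal ir))) h; rewrite ev0 ev_sum (bigD1 i) //=.
rewrite -scaler_int evZ.
have -> : ev (dual m (Ordinal ir)) m`_i = 1.
  by rewrite (dual_basis (Ordinal ir) (Ordinal ir)) // eqxx.
rewrite big1 ?addr0 ?mulr1; first by move=> /eqP; rewrite intr_eq0 => /eqP.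
move=> j ji; rewrite -scaler_int evZ.
have jr := lt_r _ (ltn_ord j).
rewrite (dual_basis (Ordinal ir) (Ordinal jr)) // (_ : _ == _ = false) ?mulr0 //.
by apply: contraNF ji => /eqP[] ij; apply/eqP/val_inj.
Qed.

(** [is_zbasis] gives neither the length of [t] nor freeness over the reals. Both come from
    comparison with a real basis [b] of [N]: the integer transition matrices satisfy [P *m Q = 1] by
    [zfree], so [t] has at most [r] members, and it spans because it yields [b]. *)
Lemma zbasis_tuple (N : set V) (t : seq V) : lattice N -> is_zbasis N t ->
  exists m, [/\ tval m = t, free m & N = zspan [set` tval m]].
Proof.
move=> [b fb Nb] [zf Nt].
have ut : uniq t.
  apply/(uniqP 0) => i j; rewrite !inE => it jt e; apply: contrapT => ij.
  (* A repetition at positions [i] and [j] would be a nontrivial integer relation. Uniqueness is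
     needed because the span of the underlying set forgets multiplicities. *)
  pose c (k : 'I_(size t)) : int := (k == i :> nat)%:Z - (k == j :> nat)%:Z.
  have /zf/(_ (Ordinal it)) : \sum_(k < size t) t`_k *~ c k = 0.
    under eq_bigr do rewrite mulrzBr.
    rewrite sumrB (bigD1 (Ordinal it)) //= eqxx big1 ?addr0; last first.
      move=> k ki; rewrite (_ : (_ == _) = false) ?mulr0z //.
      by apply: contraNF ki => /eqP ki; apply/eqP/val_inj.
    rewrite (bigD1 (Ordinal jt)) //= eqxx big1 ?addr0; last first.
      move=> k ki; rewrite (_ : (_ == _) = false) ?mulr0z //.
      by apply: contraNF ki => /eqP ki; apply/eqP/val_inj.
    by rewrite e subrr.
  by rewrite /c /= eqxx; case: eqP.
have tN i : (i < size t)%N -> N t`_i.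
  by move=> it; rewrite Nt; apply: zspan_mem; [exact: finite_seq|exact: mem_nth].
have /choice[P hP] : forall i : 'I_(size t), exists c : 'I_r -> int,
    t`_i = \sum_(j < r) b`_j *~ c j.
  move=> i; have := tN i (ltn_ord i); rewrite Nb => /(zspan_free _ fb) h.
  have /choice[c hc] : forall j, exists k : int, ev (dual b j) t`_i = k%:~R.
    by move=> j; exact/intrP.
  exists c; rewrite {1}(dual_expand t`_i fb); apply: eq_bigr => j _.
  by rewrite hc scaler_int.
have /choice[Q hQ] : forall j : 'I_r, exists c : 'I_(size t) -> int,
    b`_j = \sum_(k < size t) t`_k *~ c k.
  move=> j; have : N b`_j.
    by rewrite Nb; apply: zspan_mem; [exact: finite_seq|exact: nth_tuple_mem].
  rewrite Nt => /(zspan_seqP _ ut)[c ->]; exists (fun k => c t`_k).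
  by rewrite (big_nth 0) big_mkord.
have PQ : (\matrix_(i, j) P i j) *m (\matrix_(j, k) Q j k) = 1%:M.
  apply/matrixP => i k; rewrite !mxE.
  pose d k := \sum_j P i j * Q j k - (i == k)%:R.
  suff : d k = 0.
    move=> /eqP; rewrite subr_eq0 => /eqP <-.
    by apply: eq_bigr => j _; rewrite !mxE.
  apply: zf; rewrite /d; under eq_bigr do rewrite mulrzBr.
  rewrite sumrB [X in _ - X](bigD1 i) //= eqxx [X in _ - (_ + X)]big1 ?addr0; last first.
    by move=> k' /negPf; rewrite eq_sym => ->; rewrite mulr0z.
  apply/eqP; rewrite subr_eq0 [X in _ == X]hP; apply/eqP.
  under eq_bigr do rewrite mulrz_sumr.
  rewrite exchange_big /=; apply: eq_bigr => j _.
  rewrite hQ mulrz_suml; apply: eq_bigr => k' _.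
  by rewrite mulrC mulrzA.
have st : (size t <= r)%N by exact: mulmx1_min PQ.
have full : <<t>>%VS = fullv.
  apply/vspaceP => v; rewrite memvf (dual_expand v fb).
  apply: memv_suml => j _; apply: memvZ; rewrite hQ.
  apply: memv_suml => k _; rewrite -scaler_int; apply/memvZ/memv_span/mem_nth/ltn_ord.
have st' : (r <= size t)%N.
  by have := dim_span t; rewrite full dimvf /dim /= mul1n.
have szt : size t == r by rewrite eqn_leq st.
exists (Tuple szt); split => //=.
by rewrite /free full dimvf /dim /= mul1n (eqP szt).
Qed.

(** A vector outside [H] completes a basis of [H] to one of the whole space; the coordinate along
    that vector has kernel [H]. *)
Lemma hyperplane_lker (H : {vspace V}) : hyperplane H ->
  exists2 a : dualV, a != 0 & H = lker a.
Proof.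
move=> hH; have [v vH] : exists v, v \notin H.
  apply: contrapT => h; suff e : H = fullv.
    by move: hH; rewrite /hyperplane e dimvf /dim /= mul1n; lia.
  by apply/vspaceP => v; rewrite memvf; apply: contrapT => /negP vH; apply: h; exists v.
have sz : size (v :: vbasis H) == r by rewrite /= size_tuple; exact/eqP.
have fm : free (Tuple sz).
  rewrite /= free_cons (span_basis (vbasisP H)) vH /=; exact: basis_free (vbasisP H).
have r0 : (0 < r)%N by rewrite -hH.
pose i0 := Ordinal r0; exists (dual (Tuple sz) i0); first exact: dual_neq0.
apply/eqP; rewrite eqEdim; apply/andP; split; last first.
  have [] := etrans (dim_lker (dual_neq0 i0 fm)) (esym hH); move=> ->; exact: leqnn.
apply/subvP => w; rewrite -{1}(span_basis (vbasisP H)) => /coord_span ->.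
rewrite mem_lkerE ev_sum big1 // => j _; rewrite evZ.
have lt_r k : (k < \dim H)%N -> (k.+1 < r)%N by move: hH; rewrite /hyperplane; lia.
have jr := lt_r _ (ltn_ord j).
have := dual_basis i0 (Ordinal jr) fm; rewrite /= => ->.
by rewrite mulr0.
Qed.

End Bases.

(** * Arrangements whose chambers carry a lattice basis *)
Section Charts.
Context (R : realType) (r : nat).
Local Notation V := 'rV[R]_r.
Local Notation dualV := 'Hom('rV[R]_r, R^o).
Implicit Types (a b u : dualV) (x y v w : V) (m : r.-tuple V) (J : {set 'I_r}).
Local Notation allI := ([set: 'I_r]%SET).
Implicit Types (s : seq dualV).

(* [m] is the basis of the dual lattice generating the closed cell of [x]; the
   wall functionals of that cell are the [dual m i]. *)
Definition chart s x m : Prop :=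
  [/\ free m, forall v, cell s x v <-> forall i, 0 < ev (dual m i) v,
      forall i, dual m i \in s &
      forall a (i : 'I_r), a \in s -> ev a m`_i \is a Num.int].

Definition charted s : Prop :=
  (forall a, a \in s -> a != 0) /\
  forall x, regular s x -> exists m, chart s x m.

(** For nonzero functionals this is the condition that each line meets the root set in a root and
    its negative, or not at all. Kernels replace proportionality because walls are compared as
    hyperplanes. *)
Definition rooted s : Prop :=
  (forall a, a \in s -> - a \in s) /\
  forall a b, a \in s -> b \in s -> lker a = lker b -> a = b \/ a = - b.

Lemma closed_cell_simplex s x m : regular s x ->
  (forall v, cell s x v <-> forall i, 0 < ev (dual m i) v) ->
  closed_cell s x = simplex_cone m allI.
Proof.
move=> rx cm; have /cm xp := cell_refl rx.
apply/seteqP; split => v.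
  move=> /(cell_dir _ rx) h i; split; last by rewrite inE.
  have [//|neg] := leP 0 (ev (dual m i) v).
  have ep : 0 < - ev (dual m i) v / ev (dual m i) x by rewrite divr_gt0 // oppr_gt0.
  have /cm/(_ i) := h _ ep.
  by rewrite evD evZ divfK ?gt_eqF // subrr ltxx.
move=> h; apply/cell_dir => // e ep; apply/cm => i.
by rewrite evD evZ ltr_wpDl // ?mulr_gt0 //; have [] := h i.
Qed.

Lemma closed_cell_chart s x m : regular s x -> chart s x m ->
  closed_cell s x = simplex_cone m allI.
Proof. by move=> rx [_ cm _ _]; exact: closed_cell_simplex. Qed.

Lemma chart_vertex s x m (i : 'I_r) a : regular s x -> chart s x m -> a \in s ->
  0 <= ev a x * ev a m`_i.
Proof.
move=> rx cm as_; have fm : free m by case: cm.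
have : closed_cell s x m`_i.
  by rewrite (closed_cell_chart rx cm); apply: simplex_cone_nth; rewrite ?inE.
exact.
Qed.

(* A point of [lker a] generic up to a small error lies on no other wall, so the
   cell next to it has [lker a] as a wall. *)
Lemma wall_chart s a x0 : charted s -> a \in s -> ev a x0 = 0 ->
  exists x m i, [/\ regular s x, chart s x m, closed_cell s x x0 &
                    lker a = lker (dual m i)].
Proof.
move=> [s0 sc] as_ ax0.
pose t := [seq b <- s | lker a != lker b].
have [y0 y0a y0t] := generic_on_lker (s0 a as_) s0.
have ry0 : regular t y0 by move=> b; rewrite mem_filter => /andP[ab bs]; exact: y0t.
have [y [ry yx0 [e ep ye]]] := regular_near x0 ry0.
have ay : ev a y = 0.
  by rewrite ye evD evZ ax0 y0a mulr0 addr0.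
have [z rz] := regular_exists s0.
have [x [rx xy _]] := regular_near y rz.
have [m cm] := sc x rx.
have [fm cmv ms _] := cm.
have ycone : simplex_cone m allI y by rewrite -(closed_cell_chart rx cm).
(* If no wall of this cell had kernel [lker a], every coordinate of [y] would be positive and [y]
   would lie in the open cell, although [a] vanishes at [y]. *)
have [i hi] : exists i, lker a = lker (dual m i).
  apply: contrapT => h.
  have : cell s x y.
    apply/cmv => i; rewrite lt_neqAle; have [-> _] := ycone i; rewrite andbT eq_sym.
    apply: ry; rewrite mem_filter ms andbT; apply/eqP => hi; by apply: h; exists i.
  by move=> /(_ a as_); rewrite ay mulr0 ltxx.
exists x, m, i; split => // b bs.
have [ab|ab] := eqVneq (lker a) (lker b).
  by rewrite (_ : ev b x0 = 0) ?mulr0 //; apply/in_lker; rewrite -ab; exact/in_lker.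
have bt : b \in t by rewrite mem_filter ab.
have := xy b bs; have := yx0 b bt; have := ry b bt.
move: (ev b x) (ev b y) (ev b x0) => p q k q0 qk pq.
(* Signs are compared through the intermediate point [y], where [b] has the nonzero value [q]. *)
have : 0 <= (p * k) * (q * q).
  have -> : (p * k) * (q * q) = (p * q) * (q * k) by ring.
  by rewrite mulr_ge0.
by rewrite pmulr_lge0 // -expr2 exprn_even_gt0.
Qed.

(* The second cell is the one opposite to [x] across the relative interior
   point [\sum_(i in J) m`_i] of the face. *)
Lemma face_opposite s x m J : regular s x -> chart s x m ->
  exists2 x', regular s x' & simplex_cone m J = closed_cell s x `&` closed_cell s x'.
Proof.
move=> rx cm; have [fm cmv ms mi] := cm; have /cmv xp := cell_refl rx.
pose v := \sum_(i in J) m`_i.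
have rNx : regular s (- x) by move=> a as_; rewrite evN oppr_eq0; exact: rx.
have [x' [rx' x'v [e ep ex']]] := regular_near v rNx.
exists x' => //; rewrite (closed_cell_chart rx cm).
apply/seteqP; split => w.
  move=> h; have hT : simplex_cone m allI w.
    by move=> i; have [p _] := h i; rewrite inE.
  split => // b bs.
  have xw : 0 <= ev b x * ev b w by move: hT; rewrite -(closed_cell_chart rx cm); exact.
  (* A root vanishing at the relative interior point [v] vanishes on all generators of the face,
     hence at [w]; any other root has at [x'] the same sign as at [v], and so as at [x]. *)
  have [bv|bv] := eqVneq (ev b v) 0.
    rewrite (_ : ev b w = 0) ?mulr0 //.
    have : ev b x * ev b v = 0 by rewrite bv mulr0.
    rewrite /v ev_sum mulr_sumr => /eqP.
    rewrite psumr_eq0; last by move=> i _; exact: (chart_vertex _ rx cm bs).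
    move=> /allP b0; rewrite (dual_ev _ _ fm) big1 // => i _.
    have [iJ|iJ] := boolP (i \in J); last by rewrite (proj2 (h i)) // mul0r.
    have /implyP/(_ iJ) := b0 i (mem_index_enum _).
    by rewrite mulf_eq0 (negPf (rx b bs)) => /eqP ->; rewrite mulr0.
  have xv : 0 <= ev b x * ev b v.
    by rewrite /v ev_sum mulr_sumr sumr_ge0 // => i _; exact: (chart_vertex _ rx cm bs).
  have := x'v b bs; have := rx b bs; move: xv xw bv.
  move: (ev b x) (ev b v) (ev b x') (ev b w) => p q p' k pq pk q0 p0 pq'.
  have : 0 <= (p' * k) * ((p * q) * (p * q)).
    have -> : (p' * k) * ((p * q) * (p * q)) = (p' * q) * (p * k) * (p * q) by ring.
    by apply: mulr_ge0 => //; exact: mulr_ge0.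
  by rewrite pmulr_lge0 // -expr2 exprn_even_gt0 ?mulf_neq0.
move=> [h h'] i; have [p _] := h i; split => // iJ.
have di0 : ev (dual m i) v = 0.
  rewrite /v ev_sum big1 // => j jJ; rewrite dual_basis //.
  by case: eqP => // ij; move: iJ; rewrite ij jJ.
have := h' _ (ms i); rewrite ex' evD evZ evN di0.
rewrite add0r mulrN mulNr oppr_ge0 pmulr_rle0 ?mulr_gt0 // => wn.
by apply/eqP; rewrite eq_le wn.
Qed.

(** The supporting functional is the sum of the roots separating [x0] from some point of [G], each
    signed to be positive at [x0]. It vanishes exactly where all of these do, and there the
    remaining sign conditions already follow from those at [x0]. [G] may be infinite, since only
    finitely many roots occur. *)
Lemma bigcap_cells_face s (G : set V) x0 : G `<=` regular s -> G x0 ->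
  face (\bigcap_(x in G) closed_cell s x) (closed_cell s x0).
Proof.
move=> Gr Gx0.
pose P a := `[< exists2 x, G x & ev a x0 * ev a x < 0 >].
have uE v : ev (\sum_(a <- s | P a) ev a x0 *: a) v =
    \sum_(a <- s | P a) ev a x0 * ev a v.
  by rewrite ev_suml; apply: eq_bigr => a _; rewrite evZl.
exists (\sum_(a <- s | P a) ev a x0 *: a).
  move=> v h; rewrite -/(ev _ _) uE big_seq_cond sumr_ge0 // => a /andP[as_ _].
  exact: h.
apply/seteqP; split => v.
  move=> h; split; first exact: h.
  apply/in_lker; rewrite uE big_seq_cond big1 // => a /andP[as_ /asboolP[x Gx neg]].
  have := h _ Gx _ as_; have := h _ Gx0 _ as_; move: neg.
  move: (ev a x0) (ev a x) (ev a v) => p q k pq pk qk.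
  have : (p * k) * (q * k) <= 0.
    have -> : (p * k) * (q * k) = (p * q) * (k * k) by ring.
    by rewrite mulr_le0_ge0 ?(ltW pq) // -expr2 sqr_ge0.
  move=> le0; have /eqP : (p * k) * (q * k) = 0 by apply/eqP; rewrite eq_le le0 mulr_ge0.
  rewrite !mulf_eq0; move: pq; have [->|_] := eqVneq p 0; first by rewrite mul0r ltxx.
  have [->|_] := eqVneq q 0; first by rewrite mulr0 ltxx.
  by move=> _ /= ; rewrite orbb => /eqP ->; rewrite mulr0.
move=> [h /in_lker]; rewrite uE => /eqP.
rewrite big_seq_cond psumr_eq0; last by move=> a /andP[as_ _]; exact: h.
move=> /allP h0 x Gx a as_.
have := h _ as_; have := Gr _ Gx _ as_; have := Gr _ Gx0 _ as_.
have [neg|pos] := ltP (ev a x0 * ev a x) 0.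
  move=> p0 _ _; have /implyP : (a \in s) && P a ==> (ev a x0 * ev a v == 0) by exact: h0.
  rewrite as_ /= => hP; have /hP : P a by apply/asboolP; exists x.
  by rewrite mulf_eq0 (negPf p0) => /eqP ->; rewrite mulr0.
move: pos; move: (ev a x0) (ev a x) (ev a v) => p q k pq p0 q0 pk.
have : 0 <= (q * k) * (p * p).
  have -> : (q * k) * (p * p) = (p * q) * (p * k) by ring.
  by rewrite mulr_ge0.
by rewrite pmulr_lge0 // -expr2 exprn_even_gt0.
Qed.

(** The coordinates may be those of any chamber in [F], so that two intersections sharing a chamber
    can be compared in one basis. *)
Lemma bigcap_chambers s F x m : regular s x -> chart s x m ->
  F `<=` chambers (arrangement s) -> F (cell s x) ->
  exists J, \bigcap_(K in F) closure K = simplex_cone m J.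
Proof.
move=> rx cm Fs Fx; pose G := [set x | regular s x /\ F (cell s x)].
have -> : \bigcap_(K in F) closure K = \bigcap_(x in G) closed_cell s x.
  apply/seteqP; split => v h.
    by move=> y [ry Fy]; rewrite -closure_cell //; exact: h.
  move=> K FK; have := Fs _ FK; rewrite chambersE => -[y ry yK].
  by rewrite -yK closure_cell //; apply: h; split => //; rewrite yK.
have [fm _ _ _] := cm.
have := @bigcap_cells_face s G x; rewrite (closed_cell_chart rx cm).
move=> /(_ _ _)/face_simplex; case=> //; first by move=> y [].
by move=> J _ ->; exists J.
Qed.

Lemma intersectionsP s sigma : charted s ->
  closed_chamber_intersections (arrangement s) sigma <->
  exists x m J, [/\ regular s x, chart s x m & sigma = simplex_cone m J].
Proof.
move=> [s0 sc]; split.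
  move=> [F [Fs [K FK]] <-]; have := Fs _ FK; rewrite chambersE => -[x rx xK].
  have [m cm] := sc x rx; rewrite -xK in FK.
  have [J ->] := bigcap_chambers rx cm Fs FK.
  by exists x, m, J.
move=> [x [m [J [rx cm ->]]]]; have [x' rx' ->] := face_opposite J rx cm.
exists [set K | K = cell s x \/ K = cell s x'].
  split; last by exists (cell s x); left.
  by rewrite chambersE => _ [] ->; [exists x|exists x'].
rewrite -!closure_cell //; apply/seteqP; split => v.
  by move=> h; split; apply: h; [left|right].
by move=> [h h'] _ [] ->.
Qed.

Lemma dual_latticeP s v : dual_lattice (zspan [set` s]) v <->
  forall a, a \in s -> ev a v \is a Num.int.
Proof.
have fs : finite_set [set` s] by exact: finite_seq.
split => [h a as_|h]; first by apply/h/zspan_mem.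
apply: (zspan_ind fs).
- by rewrite -/(ev _ _) /ev zero_lfunE rpred0.
- by move=> a b ha hb; rewrite -/(ev _ _) evDl rpredD.
- by move=> a k /h ha; rewrite -/(ev _ _) evMz rpredM // intr_int.
Qed.

(** Since the dual basis lies in [s], points of the dual lattice have integer coordinates; since [s]
    is integral on [m], the converse holds. *)
Lemma dual_lattice_chart s x m : chart s x m ->
  dual_lattice (zspan [set` s]) = zspan [set` tval m].
Proof.
move=> [fm _ ms mi]; apply/seteqP; split => v.
  by move=> /dual_latticeP h; apply/zspan_free => // i; exact: h.
move=> /(zspan_free _ fm) h; apply/dual_latticeP => a as_.
by rewrite (dual_ev _ _ fm) rpred_sum // => i _; rewrite rpredM ?mi.
Qed.

Lemma finite_closed_cells s : finite_set [set closed_cell s x | x in regular s].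
Proof.
pose f (t : {ffun 'I_(size s) -> bool}) : set V :=
  [set y | forall i, if t i then 0 <= ev s`_i y else ev s`_i y <= 0].
apply: (@sub_finite_set _ _ (f @` [set: {ffun 'I_(size s) -> bool}])); last first.
  exact/finite_image/finite_finset.
move=> _ [x rx <-]; exists [ffun i : 'I_(size s) => 0 < ev s`_i x] => //.
apply/seteqP; split => y.
  move=> h a /(nthP 0)[k ks <-]; have := h (Ordinal ks); rewrite ffunE /=.
  have := rx _ (mem_nth 0 ks); case: ltP; first by move=> p _ q; rewrite mulr_ge0 // ltW.
  by move=> p _ q; rewrite mulr_le0.
move=> h i; have is_ : s`_i \in s by exact: mem_nth.
have := h _ is_; have := rx _ is_; rewrite ffunE.
case: ltP; first by move=> p _; rewrite pmulr_rge0.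
by move=> p p0; rewrite nmulr_rge0 // lt_neqAle p0.
Qed.

End Charts.

(** * Crystallographic arrangements and their fans *)
Section Crystallographic.
Context (R : realType) (r : nat).
Local Notation V := 'rV[R]_r.
Local Notation dualV := 'Hom('rV[R]_r, R^o).
Local Notation allI := ([set: 'I_r]%SET).
Implicit Types (a b u : dualV) (x y v w : V) (m : r.-tuple V) (J : {set 'I_r}).
Implicit Types (s : seq dualV).

Lemma root_set_rooted s : is_root_set (arrangement s) [set` s] ->
  (forall a, a \in s -> a != 0) -> rooted s.
Proof.
move=> [_ _ h] s0; split => [a as_|a b as_ bs e].
  have : [set a; - a] (- a) by right.
  by rewrite -(h a as_) => -[].
have [v bv] := ev_neq0 (s0 b bs).
have : [set b; - b] a.
  by rewrite -(h b bs); split => //; exists (ev a v / ev b v) => //; rewrite -(lker_prop e).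
by case=> ->; [left|right].
Qed.

Lemma rooted_root_set s : rooted s -> (forall a, a \in s -> a != 0) ->
  is_root_set (arrangement s) [set` s].
Proof.
move=> [sN sk] s0; split; [exact: finite_seq|by []|] => a as_.
apply/seteqP; split => [b [[t _ <-] bs]|b].
  have t0 : t != 0.
    by apply: contraTneq (s0 _ bs) => ->; rewrite scale0r eqxx.
  have /sk : lker (t *: a) = lker a.
    by apply/vspaceP => v; rewrite !mem_lkerE evZl mulf_eq0 (negPf t0).
  by case/(_ bs as_) => ->; [left|right].
case=> ->; split => //; [by exists 1; rewrite ?scale1r| |exact: sN].
by exists (-1); rewrite ?scaleN1r.
Qed.

Lemma wall_simplex m i : free m ->
  [set` lker (dual m i)] `&` simplex_cone m allI = simplex_cone m (~: [set i])%SET.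
Proof.
move=> fm; apply/seteqP; split => v.
  move=> [/in_lker vi h] j; have [p _] := h j; split => //.
  by rewrite !inE negbK => /eqP ->.
move=> h; split; last by move=> j; have [p _] := h j; rewrite inE.
by apply/in_lker; have [_ ->] := h i; rewrite ?inE ?eqxx.
Qed.

Lemma has_dim_wall m i : free m ->
  has_dim (simplex_cone m (~: [set i])%SET) (r%:Z - 1).
Proof.
move=> fm; apply/has_dim_simplex => //; rewrite cardsC1 card_ord.
(* The index [i] excludes [r = 0], so the natural predecessor of [r] agrees with the integer
   [r - 1]. *)
by case: r i => [[]//|k _]; lia.
Qed.

Lemma chart_wall_roots s x m i : regular s x -> chart s x m ->
  wall_roots [set` s] (cell s x) (dual m i).
Proof.
move=> rx cm; have [fm cmv ms mi] := cm; split; first exact: ms.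
  by move=> v /cmv/(_ i)/ltW.
rewrite closure_cell // (closed_cell_chart rx cm) wall_simplex //; exact: has_dim_wall.
Qed.

(** The coefficients of a root in the basis [dual m i] of wall roots are its values on [m], which
    are integers. *)
Lemma charted_crystallographic s : charted s -> rooted s ->
  crystallographic_arrangement (arrangement s, [set` s]).
Proof.
move=> [s0 sc] sr; split => /=; [split| |].
- exact/finite_image/finite_seq.
- by move=> _ [a as_ <-]; exact/dim_lker/s0.
- move=> K; rewrite chambersE => -[x rx <-]; have [m [fm cm _ _]] := sc x rx.
  exists m => //; rewrite open_cone_dual //; by apply/seteqP; split => v /= h; apply/cm.
- exact: rooted_root_set.
move=> K; rewrite chambersE => -[x rx <-] a as_; have [m cm] := sc x rx.
have [fm _ ms mi] := cm.
have /choice[c hc] : forall i : 'I_r, exists k : int, ev a m`_i = k%:~R.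
  by move=> i; apply/intrP; exact: mi.
rewrite (dual_decomp a fm); under eq_bigr do rewrite hc scaler_int.
apply: zspan_sum; last by move=> i; exact: chart_wall_roots.
by apply: (@sub_finite_set _ _ [set` s]); [move=> ? []|exact: finite_seq].
Qed.

(* The face of a simplicial cone cut out by a wall functional has codimension
   one, so that functional is positive on exactly one generator. *)
Lemma wall_root_dual s x (n : r.-tuple V) a : regular s x -> free n ->
  closed_cell s x = simplex_cone n allI -> wall_roots [set` s] (cell s x) a ->
  exists i : 'I_r, 0 < ev a n`_i /\ a = ev a n`_i *: dual n i.
Proof.
move=> rx fn ce [/= as_ ge0 hd].
have ax : 0 < ev a x.
  by rewrite lt_neqAle eq_sym rx //; apply: ge0; exact: cell_refl.
have an v : simplex_cone n allI v -> 0 <= ev a v.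
  by rewrite -ce => /(_ a as_); rewrite pmulr_rge0.
have : face ([set` lker a] `&` closure (cell s x)) (simplex_cone n allI).
  by exists a; [exact: an|rewrite closure_cell // ce setIC].
move=> /(face_simplex fn)[J _ eJ]; move: hd; rewrite eJ => /(has_dim_simplex _ _ fn) dJ.
have : #|~: J| == 1%N.
  by rewrite cardsCs finset.setCK card_ord; lia.
move=> /cards1P[i eC].
have a0 (j : 'I_r) : j != i -> ev a n`_j = 0.
  move=> ji; have jJ : j \in J by rewrite -(finset.setCK J) eC !inE.
  have := simplex_cone_nth fn jJ; rewrite -eJ => -[+ _].
  by move=> /in_lker.
have ae : a = ev a n`_i *: dual n i.
  rewrite {1}(dual_decomp a fn) (bigD1 i) //= big1 ?addr0 // => j ji.
  by rewrite a0 // scale0r.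
exists i; split => //; rewrite lt_neqAle an ?andbT; last first.
  by apply: simplex_cone_nth; rewrite ?inE.
by apply: contraTneq ax => e; rewrite ae -e scale0r /ev zero_lfunE ltxx.
Qed.

(** The crystallographic condition enters twice: it provides a wall root for every generator of a
    chamber, and it makes all roots integral on the rescaled generators. *)
Lemma crystallographic_charted (A : set {vspace V}) (Phi : set dualV) :
  crystallographic_arrangement (A, Phi) ->
  exists s, [/\ A = arrangement s, Phi = [set` s], charted s & rooted s].
Proof.
move=> [/= [_ hyp simp] rs cr]; have [fPhi eA _] := rs.
have [s es] := (finite_seqP _).1 fPhi; subst Phi A.
have s0 a : a \in s -> a != 0.
  move=> as_; apply/eqP => e.
  have : hyperplane (lker a) by apply: hyp; exists a.
  rewrite /hyperplane (_ : lker a = fullv) ?dimvf /dim /= ?mul1n; first by lia.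
  by apply/vspaceP => v; rewrite memvf mem_lkerE e /ev zero_lfunE eqxx.
have sr := root_set_rooted rs s0.
exists s; split => //; split => // x rx.
have chx : chambers (arrangement s) (cell s x) by rewrite chambersE; exists x.
have [n fn] := simp _ chx; rewrite open_cone_dual // => ceq.
have cv v : cell s x v <-> forall i, 0 < ev (dual n i) v by rewrite ceq.
have ce := closed_cell_simplex rx cv.
set W := wall_roots [set` s] (cell s x).
have fW : finite_set W.
  by apply: (@sub_finite_set _ _ [set` s]); [move=> ? []|exact: finite_seq].
have wd a : W a -> exists i : 'I_r, 0 < ev a n`_i /\ a = ev a n`_i *: dual n i.
  exact: wall_root_dual.
(* If no wall root were positive on generator [i], all wall roots, hence all roots, would vanish on
   it; the cell would then be invariant under translation along it, yet subtracting the [i]-th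
   component of [x] leaves the open cone. *)
have /choice[f hf] (i : 'I_r) : exists a, [/\ W a, 0 < ev a n`_i & a = ev a n`_i *: dual n i].
  apply: contrapT => h.
  have a0 a : a \in s -> ev a n`_i = 0.
    move=> as_; have := cr _ chx _ as_.
    apply: (@zspan_ind _ _ [set b | ev b n`_i = 0] fW) => [|b c /= hb hc|b k Wb] /=.
    - by rewrite /ev zero_lfunE.
    - by rewrite evDl hb hc addr0.
    - rewrite evMz (_ : ev b n`_i = 0) ?mul0r //.
      have [j [bp bj]] := wd b Wb.
      rewrite bj evZl dual_basis //; case: eqP => [ji|]; last by rewrite mulr0.
      by exfalso; apply: h; exists b; split => //; rewrite -ji.
  have /cv/(_ i) : cell s x (x - ev (dual n i) x *: n`_i).
    by move=> a as_; rewrite evD evN evZ a0 // mulr0 subr0; exact: (cell_refl rx as_).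
  by rewrite evD evN evZ dual_basis // eqxx mulr1 subrr ltxx.
pose t i := ev (f i) n`_i.
have tp i : 0 < t i by have [] := hf i.
have fE i : f i = t i *: dual n i by have [] := hf i.
(* The scaling for which [f i] has value 1 on generator [i]; the dual basis of [m] is then [f]
   itself. *)
have [m mE] : exists m : r.-tuple V, forall i : 'I_r, m`_i = (t i)^-1 *: n`_i.
  by exists [tuple (t i)^-1 *: n`_i | i < r] => i; rewrite -tnth_nth tnth_mktuple.
have fm_ (i j : 'I_r) : ev (f i) m`_j = (i == j)%:R.
  rewrite fE mE evZl evZ dual_basis //; case: eqP => [->|]; last by rewrite !mulr0.
  by rewrite mulr1 mulfV ?gt_eqF.
have fm : free m := free_of_dual fm_.
have dE i : dual m i = f i by rewrite (dual_unique fm (fm_ i)).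
have ms i : dual m i \in s by rewrite dE; have [[]] := hf i.
exists m; split => //.
  move=> v; rewrite cv; split => h i; have := h i; rewrite dE fE evZl pmulr_rgt0 //.
move=> a i as_; have := cr _ chx _ as_.
apply: (@zspan_ind _ _ [set b | ev b m`_i \is a Num.int] fW) =>
  [|b c /= hb hc|b k Wb] /=.
- by rewrite /ev zero_lfunE rpred0.
- by rewrite evDl rpredD.
rewrite evMz rpredM ?intr_int //.
have [j [bp bj]] := wd b Wb; have [bs _ _] := Wb.
(* Reducedness now forces the wall root [b] to be [dual m j] up to sign, so its values on [m] are 0,
   1 or -1. *)
have : lker b = lker (dual m j).
  apply/vspaceP => v; rewrite !mem_lkerE dE fE bj !evZl !mulf_eq0.
  by rewrite (gt_eqF bp) (gt_eqF (tp j)).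
move=> /(proj2 sr _ _ bs (ms j))[] ->; rewrite ?evNl ?rpredN dual_basis //; exact: natr_int.
Qed.

Lemma support_walls s : charted s ->
  Defs.support (cones_of_dim (closed_chamber_intersections (arrangement s)) (r%:Z - 1)) =
  \bigcup_(H in arrangement s) [set` H].
Proof.
move=> cs; have SE := @intersectionsP R r s ^~ cs.
apply/seteqP; split => v.
  move=> [_ [/SE[x [m [J [rx cm ->]]]] /=]]; have [fm _ ms _] := cm.
  move=> /(has_dim_simplex _ _ fm) dJ h.
  have [i iJ] : exists i, i \notin J.
    apply: contrapT => nJ; suff eJ : J = allI by move: dJ; rewrite eJ cardsT card_ord; lia.
    by apply/setP => i; rewrite inE; apply: contrapT => /negP iJ; apply: nJ; exists i.
  exists (lker (dual m i)); first by exists (dual m i); first exact: ms.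
  by apply/in_lker; have [_ ->] := h i.
move=> [_ [a as_ <-] /in_lker av].
have [x [m [i [rx cm xv ai]]]] := wall_chart cs as_ av; have [fm _ _ _] := cm.
exists (simplex_cone m (~: [set i])%SET).
  split; first by apply/SE; exists x, m, (~: [set i])%SET.
  exact: has_dim_wall.
rewrite -wall_simplex //; split; last by rewrite -(closed_cell_chart rx cm).
by rewrite -ai; exact/in_lker.
Qed.

Lemma charted_fan s : charted s ->
  strongly_symmetric_smooth_fan (fan_of_arrangement (arrangement s, [set` s])).
Proof.
move=> cs; have [s0 sc] := cs; have [z rz] := regular_exists s0.
have [mz cz] := sc z rz; rewrite /fan_of_arrangement /=.
set N := dual_lattice _; set Sigma := closed_chamber_intersections _.
have SE := @intersectionsP R r s ^~ cs.
have NE x m : chart s x m -> N = zspan [set` tval m] := @dual_lattice_chart _ _ s x m.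
split => /=.
- by exists mz; [have [] := cz|rewrite (NE _ _ cz)].
- split.
  + by exists (simplex_cone mz allI); apply/SE; exists z, mz, allI.
  + move=> _ /SE[x [m [J [rx cm ->]]]]; have [fm _ _ _] := cm.
    apply: N_cone_simplex => // v vm; rewrite (NE _ _ cm); apply: zspan_mem => //.
    exact: finite_seq.
  + move=> _ tau /SE[x [m [J [rx cm ->]]]]; have [fm _ _ _] := cm.
    by move=> /(face_simplex fm)[J' _ ->]; apply/SE; exists x, m, J'.
  (* The intersection is that of the family [F] united with [G], so both cones are written in the
     coordinates of one chamber of [F], and inclusion becomes inclusion of index sets. *)
  + have half sigma tau : Sigma sigma -> Sigma tau -> face (sigma `&` tau) sigma.
      move=> [F [Fs [K FK]] eF] [G [Gs _] eG]; have := Fs _ FK; rewrite chambersE => -[x rx xK].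
      rewrite -xK in FK; have [m cm] := sc x rx; have [fm _ _ _] := cm.
      have [J eJ] := bigcap_chambers rx cm Fs FK.
      have [J' eJ'] : exists J', sigma `&` tau = simplex_cone m J'.
        have -> : sigma `&` tau = \bigcap_(K in F `|` G) closure K.
          by rewrite bigcap_setU eF eG.
        apply: (bigcap_chambers rx cm); last by left.
        by move=> L [/Fs|/Gs].
      rewrite eJ' -eF eJ; apply: simplex_face => //; apply: (simplex_cone_sub fm).
      by rewrite -eJ' -eJ eF; exact: subIsetl.
    move=> sigma tau Ss St; split; first exact: half.
    by rewrite setIC; exact: half.
- move=> _ /SE[x [m [J [rx cm ->]]]]; have [fm _ _ _] := cm.
  exists m; first by rewrite (NE _ _ cm); exact: zbasis_free.
  exists [seq m`_i | i : 'I_r <- enum J]; last exact: simplex_cone_gens.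
  by move=> v /mapP[i _ ->]; exact: nth_tuple_mem.
- split; first split.
  + pose C := [set closed_cell s x | x in regular s].
    apply: (@sub_finite_set _ _ [set A `&` B | A in C & B in C]); last first.
      by apply: finite_image2; exact: finite_closed_cells.
    move=> _ /SE[x [m [J [rx cm ->]]]]; have [x' rx' ->] := face_opposite J rx cm.
    by exists (closed_cell s x); [exists x|exists (closed_cell s x'); [exists x'|]].
  + apply/seteqP; split => // v _; have [x [rx xv _]] := regular_near v rz.
    have [m cm] := sc x rx; exists (closed_cell s x) => //; apply/SE.
    by exists x, m, allI; rewrite (closed_cell_chart rx cm).
  + exists [seq lker a | a <- s].
      by move=> _ /mapP[a as_ ->]; exact/dim_lker/s0.
    rewrite support_walls //; congr (\bigcup_(H in _) _).
    apply/seteqP; split => [_ [a as_ <-]|_ /= /mapP[a as_ ->]]; last by exists a.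
    by rewrite /= map_f.
Qed.

End Crystallographic.

(** * From fans to arrangements *)
Section Primitive.
Context (R : realType) (r : nat).
Local Notation V := 'rV[R]_r.
Local Notation dualV := 'Hom('rV[R]_r, R^o).
Implicit Types (a b : dualV) (v : V) (m : r.-tuple V) (s : seq dualV) (N : set V).

(** For a lattice [N], these are the primitive vectors of the dual lattice. *)
Definition primitive N a : Prop :=
  (forall v, N v -> ev a v \is a Num.int) /\ exists2 v, N v & ev a v = 1.

Lemma primitive_neq0 N a : primitive N a -> a != 0.
Proof.
move=> [_ [v _ av]]; apply: contra_eq_neq av => ->.
by rewrite /ev zero_lfunE eq_sym oner_neq0.
Qed.

Lemma primitiveN N a : lattice N -> primitive N a -> primitive N (- a).
Proof.
move=> [m fm ->] [ai [v Nv av]]; split; first by move=> w Nw; rewrite evNl rpredN ai.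
exists (- v); last by rewrite evNl evN opprK.
by apply/(zspan_free _ fm) => i; rewrite evN rpredN; exact: (zspan_free v fm).1.
Qed.

(** The factor between [a] and [b] is the value of [a] at a point where [b] is 1, hence an integer;
    by symmetry so is its inverse. *)
Lemma primitive_lker N a b : primitive N a -> primitive N b ->
  lker a = lker b -> a = b \/ a = - b.
Proof.
move=> [ai [w Nw aw]] [bi [v Nv bv]] e.
have := @lker_prop _ _ a b v e; rewrite bv oner_eq0 divr1 => /(_ isT) ab.
have /intrP[k hk] := ai v Nv; have /intrP[l hl] := bi w Nw.
have : (k * l)%:~R = 1 :> R by rewrite intrM -hk -hl -evZl -ab.
rewrite -[1]/(1%:~R) => /intr_inj kl.
have [k1|k1] : k = 1 \/ k = -1.
  have /eqP := congr1 absz kl; rewrite abszM muln_eq1 => /andP[/eqP k1 _].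
  by lia.
  by left; rewrite ab hk k1 scale1r.
by right; rewrite ab hk k1 scaleN1r.
Qed.

Lemma primitive_dual m i : free m -> primitive (zspan [set` tval m]) (dual m i).
Proof.
move=> fm; split; first by move=> v /(zspan_free v fm).
exists m`_i; last by rewrite dual_basis // eqxx.
by apply: zspan_mem; [exact: finite_seq|exact: nth_tuple_mem].
Qed.

(** Every root is up to sign a member of the dual basis of some chart: [wall_chart] applied at the
    origin yields a cell with wall [lker a]. *)
Lemma charted_primitive s a : charted s -> rooted s -> a \in s ->
  primitive (dual_lattice (zspan [set` s])) a.
Proof.
move=> cs [sN sk] as_; have [x [m [i [rx cm _ ai]]]] := wall_chart cs as_ (ev0 a).
have [fm _ ms _] := cm.
have lN : lattice (zspan [set` tval m]) by exists m.
rewrite (dual_lattice_chart cm); have pi := primitive_dual i fm.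
by have [->|->] := sk a _ as_ (ms i) ai; [|exact: primitiveN].
Qed.

(** The facets of the fan recover the union of the hyperplanes, and a hyperplane inside that union
    is one of them. Its primitive normal for the common lattice is unique up to sign. *)
Lemma charted_fan_inj s t : charted s -> rooted s -> charted t -> rooted t ->
  fan_of_arrangement (arrangement s, [set` s]) =
  fan_of_arrangement (arrangement t, [set` t]) -> {subset s <= t}.
Proof.
move=> cs rs ct rt [eN eS] a as_.
have := support_walls cs; rewrite eS support_walls // => eU.
have [|||b bt ab] := @cone_in_union _ _ [set` lker a] t.
- by exists 0; rewrite /= mem0v.
- by move=> x y e /= xa ya _; rewrite memvD // memvZ.
- by rewrite eU => v av; exists (lker a) => //; exists a.
have pa := charted_primitive cs rs as_; rewrite eN in pa.
have pb := charted_primitive ct rt bt.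
have : lker a = lker b.
  apply: lker_sub_eq; rewrite ?(primitive_neq0 pa) ?(primitive_neq0 pb) // => v av.
  by apply/in_lker/ab/in_lker.
by case/(primitive_lker pa pb) => ->; rewrite ?rt.1.
Qed.

End Primitive.

(** * Recovering the roots from a strongly symmetric smooth fan *)

Section FanToArrangement.
Context (R : realType) (r : nat).
Local Notation V := 'rV[R]_r.
Local Notation dualV := 'Hom('rV[R]_r, R^o).
Local Notation allI := ([set: 'I_r]%SET).
Implicit Types (a b : dualV) (x y v w : V) (m : r.-tuple V) (J : {set 'I_r}).
Implicit Types (s t : seq dualV) (N sigma tau : set V) (Sigma : set (set V)).

Definition simplex_fan N Sigma : Prop := fan N Sigma /\
  forall sigma, Sigma sigma -> exists m J,
    [/\ free m, N = zspan [set` tval m] & sigma = simplex_cone m J].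

Lemma smooth_simplex_fan N Sigma : lattice N -> fan N Sigma -> smooth N Sigma ->
  simplex_fan N Sigma.
Proof.
move=> lN fS sS; split => // sigma /sS[t zt [n nt ->]].
have [m [mt fm Nm]] := zbasis_tuple lN zt.
exists m, [set i : 'I_r | m`_i \in n]%SET; split => //.
by rewrite -cone_simplex // mt.
Qed.

Lemma not_allI J : J != allI -> exists i, i \notin J.
Proof.
move=> JT; apply: contrapT => h; case/eqP: JT; apply/setP => i; rewrite inE.
by apply: contrapT => /negP iJ; apply: h; exists i.
Qed.

(* Otherwise, moving [v] slightly in a generic direction leaves every
   lower-dimensional cone without entering a full-dimensional one. *)
Lemma full_cones_cover N Sigma v : simplex_fan N Sigma -> complete_fan Sigma ->
  exists m, [/\ free m, N = zspan [set` tval m], Sigma (simplex_cone m allI)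
              & simplex_cone m allI v].
Proof.
move=> [_ sS] [fS cS]; apply: contrapT => h.
have /choice[f hf] sigma : exists a, Sigma sigma -> a != 0 /\
    (sigma `<=` [set` lker a] \/ ev a v < 0 /\ forall x, sigma x -> 0 <= ev a x).
  have [Ss|nS] := pselect (Sigma sigma); last by exists 0.
  have [m [J [fm Nm e]]] := sS _ Ss.
  have [JT|/not_allI[i iJ]] := eqVneq J allI.
    have [i vi] : exists i, ev (dual m i) v < 0.
      apply: contrapT => hi; apply: h; exists m; split => //; first by rewrite -JT -e.
      move=> i; rewrite inE; split => //; rewrite leNgt; apply/negP => vi.
      by apply: hi; exists i.
    exists (dual m i) => _; split; first exact: dual_neq0.
    by right; split => // x; rewrite e => /(_ i)[].
  exists (dual m i) => _; split; first exact: dual_neq0.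
  by left => x; rewrite e => /(_ i)[_ /(_ iJ)] xi; exact/in_lker.
have [t et] := (finite_seqP _).1 (finite_image f fS).
have t0 a : a \in t -> a != 0.
  move=> at_; have : [set` t] a by [].
  by rewrite -et => -[sigma /hf[? _] <-].
(* The pushed point [x] lies in some cone [sigma]. Regularity keeps it out of [lker (f sigma)], and
   a functional negative at [v] is still negative at [x], so neither alternative for [sigma] is
   possible. *)
have [w rw] := regular_exists t0; have [x [rx xv _]] := regular_near v rw.
have : Defs.support Sigma x by rewrite cS.
move=> [sigma Ss sx]; have [_ hs] := hf _ Ss.
have ft : f sigma \in t by suff : [set` t] (f sigma) by []; rewrite -et; exists sigma.
have := rx _ ft; case: hs => [/(_ _ sx)/in_lker ->|[neg /(_ _ sx) pos]].
  by rewrite eqxx.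
move=> x0; have := xv _ ft; rewrite pmulr_rge0; first by rewrite leNgt neg.
by rewrite lt_neqAle eq_sym x0.
Qed.

(** A face of a cone containing a relative interior point is the whole cone, so the intersection
    with [tau] is the first cone itself. *)
Lemma cone_meets_interior N Sigma m J tau x : simplex_fan N Sigma -> free m ->
  Sigma (simplex_cone m J) -> Sigma tau -> simplex_cone m J x -> tau x ->
  (forall i, i \in J -> 0 < ev (dual m i) x) ->
  face (simplex_cone m J) tau.
Proof.
move=> [[_ _ _ fI] _] fm Ss St sx tx pos; have [fs ft] := fI _ _ Ss St.
have [J' J'J eJ'] := face_simplex fm fs.
have {J'J}eJ : J' = J.
  apply/eqP; rewrite finset.eqEsubset J'J; apply/fintype.subsetP => i iJ.
  have : simplex_cone m J' x by rewrite -eJ'.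
  move=> /(_ i)[_ h]; apply: contrapT => /negP /h xi.
  by have := pos i iJ; rewrite xi ltxx.
by rewrite -eJ -eJ'.
Qed.

Lemma wall_lker m i a : free m -> a != 0 ->
  simplex_cone m (~: [set i])%SET `<=` [set` lker a] -> lker a = lker (dual m i).
Proof.
move=> fm a0 sub; apply/esym/lker_sub_eq; rewrite ?dual_neq0 // => v vi.
rewrite (dual_ev _ _ fm) big1 // => j _; have [->|ji] := eqVneq j i.
  by rewrite vi mul0r.
have /sub/in_lker -> : simplex_cone m (~: [set i])%SET m`_j.
  by apply: simplex_cone_nth; rewrite ?inE.
by rewrite mulr0.
Qed.

Section WithWalls.
Context (N : set V) (Sigma : set (set V)) (t : seq dualV).
Context (lN : lattice N) (fS : simplex_fan N Sigma).
Context (t0 : forall a, a \in t -> a != 0).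
Context (eU : Defs.support (cones_of_dim Sigma (r%:Z - 1)) =
  \bigcup_(H in arrangement t) [set` H]).

(** An interior point on one of the hyperplanes would lie in a cone of dimension [r - 1], and the
    full-dimensional cone would then be a face of it. *)
Lemma interior_regular m x : free m -> Sigma (simplex_cone m allI) ->
  (forall i, 0 < ev (dual m i) x) -> regular t x.
Proof.
move=> fm Sm xp a at_; apply/negP => /eqP ax.
have : Defs.support (cones_of_dim Sigma (r%:Z - 1)) x.
  by rewrite eU; exists (lker a); [exists a|exact/in_lker].
move=> [tau [St /= dt] tx].
have sx : simplex_cone m allI x by move=> i; rewrite inE; split => //; exact: ltW.
have [u _ eu] := cone_meets_interior fS fm Sm St sx tx (fun i _ => xp i).
have [m' [J [fm' _ etau]]] := fS.2 _ St; move: dt; rewrite etau.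
move=> /(has_dim_simplex _ _ fm') dJ.
have [|i iJ] := @not_allI J.
  by apply/eqP => e; move: dJ; rewrite e cardsT card_ord; lia.
have := dual_neq0 i fm'; rewrite (dual_decomp (dual m' i) fm) big1 ?eqxx // => j _.
have : tau m`_j.
  have : simplex_cone m allI m`_j by apply: simplex_cone_nth; rewrite ?inE.
  by rewrite eu => -[].
by rewrite etau => /(_ i)[_ /(_ iJ) ->]; rewrite scale0r.
Qed.

Lemma wall_in_union m J : free m -> Sigma (simplex_cone m J) ->
  has_dim (simplex_cone m J) (r%:Z - 1) ->
  exists2 a, a \in t & simplex_cone m J `<=` [set` lker a].
Proof.
move=> fm Sm dm; apply: cone_in_union.
- by exists 0 => i; rewrite ev0.
- by move=> x y e hx hy ep; apply: simplex_coneD => //; exact: ltW.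
- by rewrite -eU => x hx; exists (simplex_cone m J).
Qed.

Lemma wall_of_full m i : free m -> Sigma (simplex_cone m allI) ->
  Sigma (simplex_cone m (~: [set i])%SET) /\
  exists2 a, a \in t & lker a = lker (dual m i).
Proof.
move=> fm Sm; have [[_ _ fF _] _] := fS.
have Sw : Sigma (simplex_cone m (~: [set i])%SET).
  by apply: fF Sm _; apply: simplex_face => //; exact: finset.subsetT.
split => //; have [a at_ sub] := wall_in_union fm Sw (has_dim_wall i fm).
by exists a => //; apply: wall_lker => //; exact: t0.
Qed.

(** A point of [lker a] on no other hyperplane lies in a facet; the hyperplane containing that facet
    can only be [lker a], and smoothness makes the facet's normal a dual basis vector of [N]. *)
Lemma primitive_normal a : a \in t ->
  exists b, primitive N b /\ lker b = lker a.
Proof.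
move=> at_; have [y ya gy] := generic_on_lker (t0 at_) t0.
have : Defs.support (cones_of_dim Sigma (r%:Z - 1)) y.
  by rewrite eU; exists (lker a); [exists a|exact/in_lker].
move=> [tau [St /= dt] ty]; have [m [J [fm Nm etau]]] := fS.2 _ St.
rewrite etau in St dt ty.
have [b bt sub] := wall_in_union fm St dt.
have ba : lker a = lker b.
  apply/eqP; apply: contrapT => /negP /(gy _ bt); rewrite (_ : ev b y = 0) ?eqxx //.
  by apply/in_lker/sub.
move: dt => /(has_dim_simplex _ _ fm) dJ.
have : #|~: J| == 1%N by rewrite cardsCs finset.setCK card_ord; lia.
move=> /cards1P[i eC]; exists (dual m i); split; first by rewrite Nm; exact: primitive_dual.
rewrite ba; apply/esym/wall_lker => //; first exact: t0.
by rewrite -eC finset.setCK.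
Qed.

Lemma primitive_normals : exists s,
  [/\ forall b, b \in s <-> primitive N b /\ exists2 a, a \in t & lker b = lker a,
      rooted s, forall b, b \in s -> b != 0 & forall x, regular s x <-> regular t x].
Proof.
have /choice[p hp] a : exists b, a \in t -> primitive N b /\ lker b = lker a.
  have [at_|nt] := boolP (a \in t); last by exists 0.
  by have [b hb] := primitive_normal at_; exists b.
pose s := [seq p a | a <- t] ++ [seq - p a | a <- t].
have lkerN a : lker (- a) = lker a.
  by apply/vspaceP => v; rewrite !mem_lkerE evNl oppr_eq0.
have sP b : b \in s <-> primitive N b /\ exists2 a, a \in t & lker b = lker a.
  split.
    rewrite mem_cat => /orP[] /mapP[a at_ ->]; have [pa ea] := hp a at_.
      by split => //; exists a.
    by split; [exact: primitiveN|exists a => //; rewrite lkerN].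
  move=> [pb [a at_ ab]]; have [pa ea] := hp a at_; rewrite -ea in ab.
  rewrite mem_cat; apply/orP.
  by case: (primitive_lker pb pa ab) => ->; [left|right]; apply: map_f.
have s0 b : b \in s -> b != 0 by move=> /sP[/primitive_neq0].
exists s; split => //.
- split => [b /sP[pb [a at_ ab]]|b c /sP[pb _] /sP[pc _]]; last exact: primitive_lker pb pc.
  by apply/sP; split; [exact: primitiveN|exists a => //; rewrite lkerN].
- move=> x; split => rx.
    move=> a at_; have [pa ea] := hp a at_.
    have /rx : p a \in s by apply/sP; split => //; exists a.
    by rewrite -!mem_lkerE ea.
  by move=> b /sP[_ [a at_ ab]]; have := rx a at_; rewrite -!mem_lkerE ab.
Qed.

End WithWalls.

Lemma fan_charted N Sigma : strongly_symmetric_smooth_fan (N, Sigma) ->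
  exists s, [/\ charted s, rooted s &
    fan_of_arrangement (arrangement s, [set` s]) = (N, Sigma)].
Proof.
move=> [/= lN fanS smS [cS [Hs hypS eHs]]].
have fS := smooth_simplex_fan lN fanS smS.
have [t t0 eU] : exists2 t, forall a, a \in t -> a != 0 &
    Defs.support (cones_of_dim Sigma (r%:Z - 1)) = \bigcup_(H in arrangement t) [set` H].
  have /choice[g hg] H : exists a, H \in Hs -> a != 0 /\ H = lker a.
    have [HH|nH] := boolP (H \in Hs); last by exists 0.
    by have [a a0 Ha] := hyperplane_lker (hypS _ HH); exists a.
  exists [seq g H | H <- Hs]; first by move=> _ /mapP[H /hg[? _] ->].
  rewrite eHs; congr (\bigcup_(H in _) _); apply/seteqP; split => [H HH|_ [a + <-]].
    by exists (g H); [exact: map_f|have [_ <-] := hg H HH].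
  by move=> /mapP[H HH ->]; have [_ <-] := hg H HH.
have [s [sP rs s0 rst]] := primitive_normals lN fS t0 eU.
have full_chart m x : free m -> N = zspan [set` tval m] -> Sigma (simplex_cone m allI) ->
    (forall i, 0 < ev (dual m i) x) -> regular s x /\ chart s x m.
  move=> fm Nm Sm xp.
  have reg v : (forall i, 0 < ev (dual m i) v) -> regular s v.
    by move=> vp; apply/rst; exact: interior_regular fS eU _ _ fm Sm vp.
  have ms i : dual m i \in s.
    apply/sP; split; first by rewrite Nm; exact: primitive_dual.
    by have [_ [a at_ e]] := wall_of_full fS t0 eU i fm Sm; exists a.
  split; first exact: reg.
  split => // [v|a i /sP[[ai _] _]]; last first.
    by apply: ai; rewrite Nm; apply: zspan_mem; [exact: finite_seq|exact: nth_tuple_mem].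
  split => [h i|vp a as_]; first by have := h _ (ms i); rewrite pmulr_rgt0.
  have ax := reg x xp a as_; rewrite ltNge; apply/negP => le0.
  have av : ev a v != 0 by exact: reg.
  (* If [a] had opposite signs at two points of the open cone, it would vanish at the point
     [v + c *: x], which is still in the cone and hence regular. *)
  pose c := - ev a v / ev a x.
  have cp : 0 < c.
    have -> : c = - (ev a x * ev a v) / (ev a x ^+ 2) by rewrite /c; field.
    rewrite divr_gt0 ?exprn_even_gt0 // oppr_gt0 lt_neqAle le0 andbT.
    by rewrite mulf_neq0.
  have /reg/(_ a as_) : forall i, 0 < ev (dual m i) (v + c *: x).
    by move=> i; rewrite evD evZ; apply: addr_gt0; [exact: vp|exact: mulr_gt0].
  by rewrite evD evZ divfK // subrr eqxx.
(* Some full-dimensional cone contains [x]. On its boundary [x] would lie in a facet, hence on a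
   hyperplane, against regularity. *)
have full_at x : regular s x -> exists m,
    [/\ Sigma (simplex_cone m allI), N = zspan [set` tval m] & chart s x m].
  move=> rx; have [m [fm Nm Sm sx]] := full_cones_cover x fS cS.
  exists m; split => //; apply: (full_chart m x _ _ _ _).2 => // i.
  rewrite lt_neqAle; have [-> _] := sx i; rewrite andbT eq_sym; apply/eqP => xi.
  have [Sw _] := wall_of_full fS t0 eU i fm Sm.
  have : Defs.support (cones_of_dim Sigma (r%:Z - 1)) x.
    exists (simplex_cone m (~: [set i])%SET); first by split; last exact: has_dim_wall.
    by rewrite -wall_simplex //; split => //; exact/in_lker.
  rewrite eU => -[_ [a at_ <-] /in_lker ax].
  by have /rst/(_ a at_) := rx; rewrite ax eqxx.
have cs : charted s by split => // x /full_at[m [_ _ cm]]; exists m.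
have full_point m : free m -> N = zspan [set` tval m] -> Sigma (simplex_cone m allI) ->
    exists x, regular s x /\ chart s x m.
  move=> fm Nm Sm; exists (\sum_(i < r) 1 *: m`_i); apply: full_chart => // i.
  by rewrite (dual_sum i (fun=> 1)).
exists s; split => //; rewrite /fan_of_arrangement /=; congr pair.
  have [x /full_at[m [_ Nm cm]]] := regular_exists s0.
  by rewrite (dual_lattice_chart cm).
have [[_ _ fF _] sS] := fS.
apply/seteqP; split => sigma.
  move=> /(intersectionsP _ cs)[x [m [J [rx cm ->]]]]; have [fm _ _ _] := cm.
  have [m' [Sm' _ cm']] := full_at x rx.
  rewrite -(closed_cell_chart rx cm') (closed_cell_chart rx cm) in Sm'.
  apply: fF Sm' _; apply: simplex_face => //; exact: finset.subsetT.
move=> Ss; have [m [J [fm Nm es]]] := sS _ Ss.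
(* A relative interior point of [sigma]: a full-dimensional cone through it has [sigma] as a face
   and is itself a closed cell. *)
pose x := \sum_(i < r) (i \in J)%:R *: m`_i.
have xi i : ev (dual m i) x = (i \in J)%:R by rewrite (dual_sum i (fun i => (i \in J)%:R)).
have sx : simplex_cone m J x.
  by move=> i; rewrite xi ler0n; split => // /negPf ->.
have [m' [fm' Nm' Sm' sx']] := full_cones_cover x fS cS.
rewrite es in Ss *.
have := cone_meets_interior fS fm Ss Sm' sx sx'.
move=> /(_ _)/(face_simplex fm')[|J' _ ->]; first by move=> i iJ; rewrite xi iJ ltr01.
have [y [ry cy]] := full_point m' fm' Nm' Sm'.
by apply/(intersectionsP _ cs); exists y, m', J'.
Qed.

End FanToArrangement.

Theorem theorem1p1 (R : realType) (r : nat) :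
  set_bij (@crystallographic_arrangement R r)
          (@strongly_symmetric_smooth_fan R r)
          (@fan_of_arrangement R r).
Proof.
split.
- move=> [A Phi] /crystallographic_charted[s [-> -> cs _]]; exact: charted_fan.
- move=> [A Phi] [B Psi] /set_mem/crystallographic_charted[s [-> -> cs rs]].
  move=> /set_mem/crystallographic_charted[t [-> -> ct rt]] e.
  have : [set` s] = [set` t].
    by apply/seteqP; split; [exact: charted_fan_inj e|exact: charted_fan_inj (esym e)].
  by rewrite /arrangement => ->.
- move=> [N Sigma] /fan_charted[s [cs rs e]].
  by exists (arrangement s, [set` s]) => //; exact: charted_crystallographic.
Qed.
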